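(* Let $s$ be a positive integer and $d\geq 3$ an integer. If $s$ is even, assume further that $d$ is not twice a perfect square. Let $r=\lceil s/2\rceil-1$. Then, among the set of primes $p\equiv 1 \pmod d$, the lower asymptotic density of the set of primes $p$ for which there is no $A\subset\mathbb{F}_{p^s}$ with $A\hat{+}A=S_d(\mathbb{F}_{p^s})$ is at least $1-\frac{(d-1)^r}{4d^r}$.
   Context: For a prime power $q$ and $d\mid(q-1)$ with $d>1$, $S_d(\mathbb{F}_q)=\{x^d: x\in\mathbb{F}_q^*\}$, the subgroup of $\mathbb{F}_q^*$ of order $\frac{q-1}{d}$. For $A\subset\mathbb{F}_q$, $A\hat{+}A=\{a+b: a,b\in A,\ a\neq b\}$. The lower asymptotic density of a set $\mathcal{B}$ of primes among the set $\mathcal{P}_d$ of primes $p\equiv 1\pmod d$ is $\liminf_{x\to\infty}\frac{\#\{p\le x: p\in\mathcal{B}\cap\mathcal{P}_d\}}{\#\{p\le x: p\in\mathcal{P}_d\}}$. *)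

(* Defs.v *)
From mathcomp Require Import all_boot all_order all_algebra.
From mathcomp Require Import boolp classical_sets reals ereal sequences.

Set Implicit Arguments.
Unset Strict Implicit.
Unset Printing Implicit Defensive.

Import Order.TTheory GRing.Theory Num.Theory.
Local Open Scope ring_scope.

Definition dpowers (F : finFieldType) (d : nat) : {set F} :=
  [set x ^+ d | x in F & x != 0].

Definition restricted_sumset (F : finFieldType) (A : {set F}) : {set F} :=
  [set a + b | a in A, b in A & a != b].

(* Finite fields of the same cardinality are isomorphic, so quantifying over
   all fields F with q elements amounts to speaking about F_q. *)
Definition not_restricted_sumset (d q : nat) : Prop :=
  forall F : finFieldType, #|F| = q ->
    ~ exists A : {set F}, restricted_sumset A = dpowers F d.

Definition prime_count (B : set nat) (x : nat) : nat :=
  count (fun p => prime p && `[< B p >]) (iota 0 x.+1).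

(* The counting functions only jump at integers, so the liminf may be taken
   over natural x. For the finitely many x with no prime p <= x in C, the
   quotient is 0 / 0 = 0, which does not affect the liminf when C contains
   infinitely many primes. *)
Definition lower_prime_density (R : realType) (C B : set nat) : \bar R :=
  limn_einf (fun x : nat =>
    ((prime_count (B `&` C)%classic x)%:R / (prime_count C x)%:R : R)%:E).

(* Main.v *)
(* Idea. Let N = (q - 1) / d with q = p^s. If A ^+ A = S_d(F_q), then
   (a + b)^N = 1 for all distinct a, b in A, and 2 N <= |A| (|A| - 1); after
   shrinking A, one may take |A| minimal for this inequality. Let
   c_a = 1 / prod_(b <> a) (a - b), so that sum_a c_a a^k is 0 for k < |A| - 1
   and 1 for k = |A| - 1, and consider the Stepanov polynomials
     P_(t,m) = sum_(a in A) c_a (X - a)^t (X + a)^(N + m),  t + m < |A|.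
   The weights make their degree at most N + t + m + 1 - |A|, and up to an
   additive constant they vanish to high order at every point of A. For
   T = floor(|A| / 2) there are too many zeros, so P_(T,T-1) is constant. Its
   Taylor coefficients of order T, T + 1, T + 2 at b in A then determine the
   first two derivatives of prod_(a in A) (X - a) at -b, and comparing them
   yields a polynomial relation between T and N modulo p. The same zero counts
   make N an explicit quadratic polynomial in T, and d N = -1 modulo p, so p
   divides one of a few nonzero integers depending only on d. This is
   impossible for p >= 100 d^2. Hence every prime p = 1 mod d with
   p >= 100 d^2 is good, and since there are infinitely many primes
   p = 1 mod d (prime divisors of values of the d-th cyclotomic polynomial),
   the lower density is in fact 1. *)

Require Import Defs.
From mathcomp Require Import all_boot all_order all_algebra all_field ring zify lra.
From mathcomp Require Import boolp classical_sets reals ereal sequences.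
From mathcomp Require Import topology normedtype.

Set Implicit Arguments.
Unset Strict Implicit.
Unset Printing Implicit Defensive.

Import Order.TTheory GRing.Theory Num.Theory.
Local Open Scope ring_scope.

(** * Lagrange weights *)

Section Weights.
Variables (F : finFieldType).
Implicit Types (A : {set F}) (a b : F) (p q : {poly F}).

Definition set_poly A : {poly F} := \prod_(a in A) ('X - a%:P).
Definition weight A a : F := (set_poly (A :\ a)).[a]^-1.
(** When [- b] is not in [A], this is minus the Taylor coefficient of order [e] at [- b] of 1 /
    [set_poly A], whose partial fraction expansion is sum_a c_a / (X - a). *)
Definition weighted_sum A b (e : nat) : F :=
  \sum_(a in A) weight A a / (b + a) ^+ e.+1.

Lemma set_polyE A : set_poly A = \prod_(a <- enum A) ('X - a%:P).
Proof. by rewrite big_enum. Qed.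

Lemma monic_set_poly A : set_poly A \is monic.
Proof. by apply: monic_prod => a _; apply: monicXsubC. Qed.

Lemma size_set_poly A : size (set_poly A) = #|A|.+1.
Proof. by rewrite set_polyE size_prod_XsubC -cardE. Qed.

Lemma root_set_poly A a : root (set_poly A) a = (a \in A).
Proof. by rewrite set_polyE root_prod_XsubC mem_enum. Qed.

Lemma set_polyD1 A a : a \in A -> set_poly A = ('X - a%:P) * set_poly (A :\ a).
Proof. by move=> aA; rewrite /set_poly (big_setD1 a). Qed.

Lemma weight_neq0 A a : weight A a != 0.
Proof.
by rewrite invr_eq0 -/(root _ _) root_set_poly !inE eqxx.
Qed.

Lemma weight_deriv A a : a \in A -> weight A a = ((set_poly A)^`()).[a]^-1.
Proof.
move=> aA; congr (_^-1); rewrite (set_polyD1 aA) derivM derivXsubC mul1r.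
by rewrite !hornerE subrr mul0r addr0.
Qed.

Lemma poly_eq_on A p q : (size p <= #|A|)%N -> (size q <= #|A|)%N ->
  (forall a, a \in A -> p.[a] = q.[a]) -> p = q.
Proof.
move=> sp sq e; apply/eqP; rewrite -subr_eq0; apply/eqP.
apply: (@roots_geq_poly_eq0 _ _ (enum A)).
- by apply/allP => a; rewrite mem_enum => aA; rewrite rootE !hornerE e ?subrr.
- exact: enum_uniq.
- by rewrite -cardE (leq_trans (size_polyD _ _)) // size_polyN geq_max sp sq.
Qed.

(* Compare the top coefficients of [q] and of its Lagrange interpolant. *)
Lemma sum_weight_horner A q : (size q <= #|A|)%N ->
  \sum_(a in A) weight A a * q.[a] = q`_(#|A|.-1).
Proof.
move=> sq.
have sL a : a \in A -> size (set_poly (A :\ a)) = #|A|.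
  by move=> aA; rewrite size_set_poly (cardsD1 a A) aA.
have -> : q = \sum_(a in A) (weight A a * q.[a]) *: set_poly (A :\ a).
  apply: (poly_eq_on sq) => [|b bA].
    apply/leq_sizeP => i le_i; rewrite coef_sum big1 // => a aA.
    by rewrite coefZ nth_default ?mulr0 ?sL.
  rewrite horner_sum (bigD1 b) //= big1 => [|a /andP[aA ab]].
    rewrite addr0 hornerZ mulrAC /weight mulVf ?mul1r //.
    by rewrite -/(root _ _) root_set_poly !inE eqxx.
  rewrite hornerZ; apply/eqP; rewrite mulf_eq0 -/(root _ _) root_set_poly.
  by rewrite !inE bA andbT [b == a]eq_sym ab orbT.
rewrite coef_sum; apply: eq_bigr => a aA; rewrite coefZ.
have -> : (set_poly (A :\ a))`_(#|A|.-1) = 1.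
  by rewrite -(sL a aA); apply/eqP/monic_set_poly.
rewrite mulr1; congr (_ * _); rewrite horner_sum (bigD1 a) //= big1 => [|b /andP[bA ba]].
  rewrite addr0 hornerZ mulrAC mulVf ?mul1r //.
  by rewrite -/(root _ _) root_set_poly !inE eqxx.
rewrite hornerZ; apply/eqP; rewrite mulf_eq0 -/(root _ _) root_set_poly.
by rewrite !inE aA andbT [a == b]eq_sym ba orbT.
Qed.

Lemma size_monomial b i k :
  size (('X + b%:P) ^+ i * ('X - b%:P) ^+ k : {poly F}) = (i + k).+1.
Proof.
have -> : 'X + b%:P = 'X - (- b)%:P :> {poly F} by rewrite polyCN opprK.
rewrite size_Mmonic ?monic_exp ?monicXsubC ?expf_neq0 ?polyXsubC_eq0 //.
by rewrite !size_exp_XsubC addnS.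
Qed.

(** As a polynomial in a, the product has degree [i + k] and leading coefficient (-1)^k, and the
    weights see only the coefficient of degree |A| - 1. *)
Lemma sum_weight_monomial A b i k : (i + k < #|A|)%N ->
  \sum_(a in A) weight A a * ((b + a) ^+ i * (b - a) ^+ k) =
  (-1) ^+ k *+ ((i + k).+1 == #|A|).
Proof.
move=> ik; pose q : {poly F} := ('X + b%:P) ^+ i * ('X - b%:P) ^+ k.
have sq : size q = (i + k).+1 by apply: size_monomial.
have mq : q \is monic by rewrite monicMl monic_exp ?monicXsubC ?monicXaddC.
have -> : \sum_(a in A) weight A a * ((b + a) ^+ i * (b - a) ^+ k) =
    (-1) ^+ k * \sum_(a in A) weight A a * q.[a].
  rewrite mulr_sumr; apply: eq_bigr => a _.
  rewrite /q hornerM !horner_exp hornerXsubC hornerD hornerX hornerC.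
  by rewrite [b + a]addrC -[b - a]opprB (exprNn (a - b)); ring.
rewrite sum_weight_horner ?sq // -mulr_natr; congr (_ * _).
case: eqP => [<- /=|]; first by move/monicP: mq; rewrite /lead_coef sq.
by move=> ne; rewrite nth_default // sq; lia.
Qed.

(** Translating the variable does not change the coefficient of degree |A| - 1 of a polynomial of at
    most that degree. *)
Lemma sum_weight_shift A b q : (size q <= #|A|)%N ->
  \sum_(a in A) weight A a * q.[b + a] = q`_(#|A|.-1).
Proof.
move=> sq; under eq_bigr do rewrite (horner_coef_wide _ sq) mulr_sumr.
rewrite exchange_big /=.
have e (i : 'I_#|A|) :
    \sum_(a in A) weight A a * (q`_i * (b + a) ^+ i) = q`_i *+ (i.+1 == #|A|).
  have := @sum_weight_monomial A b i 0; rewrite addn0 => /(_ (ltn_ord i)) h.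
  rewrite expr0 in h; rewrite -mulr_natr -h mulr_sumr.
  by apply: eq_bigr => a _; rewrite expr0 mulr1 mulrCA.
under eq_bigr do rewrite e.
case: (posnP #|A|) => [A0|A_gt0].
  rewrite nth_default; last by rewrite (leq_trans sq) ?A0.
  by rewrite big1 // => -[i lt_i] _; exfalso; rewrite A0 in lt_i.
have lt : (#|A|.-1 < #|A|)%N by rewrite prednK.
rewrite (bigD1 (Ordinal lt)) //= prednK // eqxx mulr1n big1 ?addr0 // => i.
rewrite -val_eqE /= => ne; case: eqP => // ei.
by rewrite -[X in _ != X.-1]ei eqxx in ne.
Qed.

(** Cut [q] at degree [e.+1]: the low terms leave negative powers of b + a, that is, weighted sums,
    and the quotient of the rest by X^(e+1) contributes only its top coefficient. *)
Lemma weighted_sum_horner A b q e : - b \notin A -> (0 < #|A|)%N ->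
  (size q <= #|A| + e.+1)%N ->
  \sum_(a in A) weight A a * (q.[b + a] / (b + a) ^+ e.+1) =
  \sum_(i < e.+1) q`_i * weighted_sum A b (e - i) + q`_(#|A| + e).
Proof.
move=> bA A_gt0 sq; have nz a : a \in A -> b + a != 0.
  by move=> aA; apply: contraNneq bA => /eqP; rewrite addrC addr_eq0 => /eqP <-.
rewrite {1}(esym (poly_take_drop e.+1 q)).
transitivity (\sum_(a in A) \sum_(i < e.+1) q`_i * (weight A a / (b + a) ^+ (e - i).+1) +
   \sum_(a in A) weight A a * (drop_poly e.+1 q).[b + a]).
  rewrite -big_split /=; apply: eq_bigr => a aA.
  rewrite hornerD hornerM hornerXn mulrDl mulfK ?expf_neq0 ?nz // mulrDr.
  congr (_ + _); rewrite (horner_coef_wide _ (size_take_poly _ _)).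
  rewrite mulr_suml mulr_sumr; apply: eq_bigr => i _.
  rewrite coef_take_poly ltn_ord; have le : (i <= e)%N by rewrite -ltnS.
  have -> : (b + a) ^+ e.+1 = (b + a) ^+ (e - i).+1 * (b + a) ^+ i.
    by rewrite -exprD addSn subnK.
  by field; rewrite !expf_neq0 ?nz.
rewrite exchange_big /= sum_weight_shift ?size_drop_poly; last by lia.
rewrite coef_drop_poly; have -> : (#|A|.-1 + e.+1 = #|A| + e)%N.
  by rewrite addnS -addSn prednK.
congr (_ + _).
by apply: eq_bigr => i _; rewrite mulr_sumr.
Qed.

(** The Cauchy product for [set_poly A] times its inverse in Taylor coefficients at [- b]. It
    follows because the translated polynomial vanishes at each b + a. *)
Lemma weighted_sum_comp A b e : - b \notin A -> (0 < #|A|)%N ->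
  \sum_(i < e.+1) (set_poly A \Po ('X - b%:P))`_i * weighted_sum A b (e - i)
  = - (e == 0)%:R.
Proof.
move=> bA A_gt0; set q := _ \Po _.
have sq : size q = #|A|.+1 by rewrite size_comp_poly2 ?size_XsubC ?size_set_poly.
have mq : q \is monic.
  rewrite monicE lead_coef_comp ?size_XsubC // lead_coefXsubC expr1n mulr1.
  exact: monic_set_poly.
have h0 : \sum_(a in A) weight A a * (q.[b + a] / (b + a) ^+ e.+1) = 0.
  apply: big1 => a aA; have -> : q.[b + a] = (set_poly A).[a].
    by rewrite [LHS]horner_comp hornerXsubC [b + a]addrC addrK.
  by have /rootP-> : root (set_poly A) a; rewrite ?root_set_poly // mul0r mulr0.
have := @weighted_sum_horner A b q e bA A_gt0; rewrite h0 sq.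
rewrite addnS ltnS leq_addr => /(_ isT)/esym/eqP.
rewrite addr_eq0 => /eqP->; congr (- _); case: e {h0} => [|e] /=.
  by rewrite addn0; move/monicP: mq; rewrite /lead_coef sq.
by rewrite nth_default // sq addnS ltnS leq_addr.
Qed.

End Weights.

(** * Stepanov polynomials *)

Section Stepanov.
Variables (F : finFieldType) (N : nat).
Implicit Types (A : {set F}) (a b u : F) (p q : {poly F}).

Definition sums_in A := forall a b, a \in A -> b \in A -> a != b -> (a + b) ^+ N = 1.

Definition stepanov A (t m : nat) : {poly F} :=
  \sum_(a in A) weight A a *: (('X - a%:P) ^+ t * ('X + a%:P) ^+ (N + m)).

Lemma coef_XaddC_exp u n k : (('X + u%:P) ^+ n)`_k = u ^+ (n - k) *+ 'C(n, k).
Proof.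
rewrite addrC exprDn coef_sum.
under eq_bigr do rewrite coefMn -polyC_exp mul_polyC coefZ coefXn.
have [lt|le] := ltnP n k.
  rewrite bin_small // mulr0n big1 // => i _.
  by rewrite gtn_eqF ?mulr0 ?mul0rn // (leq_ltn_trans _ lt) // -ltnS.
have lt : (k < n.+1)%N by [].
rewrite (bigD1 (Ordinal lt)) //= eqxx mulr1 big1 ?addr0 // => i.
by rewrite -val_eqE /= eq_sym => /negPf->; rewrite mulr0 mul0rn.
Qed.

Lemma coef_stepanov_shift A t m b K :
  (stepanov A t m \Po ('X + b%:P))`_K = \sum_(a in A) weight A a *
    \sum_(j < K.+1) ((b + a) ^+ (N + m - j) *+ 'C(N + m, j)) *
                    ((b - a) ^+ (t - (K - j)) *+ 'C(t, K - j)).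
Proof.
rewrite /stepanov raddf_sum coef_sum /=; apply: eq_bigr => a _.
rewrite comp_polyZ coefZ; congr (_ * _).
rewrite rmorphM !rmorphXn /= comp_polyB comp_polyD comp_polyX !comp_polyC.
rewrite mulrC -!addrA -polyCB -polyCD coefM; apply: eq_bigr => j _.
by rewrite !coef_XaddC_exp.
Qed.

(** For [K <= m], the Taylor coefficient of order [K] at [b] of (X - a)^t (X + a)^(N + m), with the
    factor (b + a)^N removed. *)
Definition local_coef b t m K a : F :=
  \sum_(j < K.+1) ((b + a) ^+ (m - j) *+ 'C(N + m, j)) *
                  ((b - a) ^+ (t - (K - j)) *+ 'C(t, K - j)).

(** Every term has total degree [t + m - K] in b + a and b - a, so the weights kill all of them
    unless [K] is 0 and this degree is |A| - 1. *)
Lemma sum_local_coef A b t m K : (K <= m)%N -> (t + m < #|A|)%N ->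
  \sum_(a in A) weight A a * local_coef b t m K a =
  (-1) ^+ t *+ ((K == 0%N) && ((t + m).+1 == #|A|)).
Proof.
move=> Km tm; rewrite /local_coef; under eq_bigr do rewrite mulr_sumr.
rewrite exchange_big /=.
have e (j : 'I_K.+1) : \sum_(a in A) weight A a *
    (((b + a) ^+ (m - j) *+ 'C(N + m, j)) *
                  ((b - a) ^+ (t - (K - j)) *+ 'C(t, K - j))) =
    (-1) ^+ t *+ ((K == 0%N) && ((t + m).+1 == #|A|)) *+ (j == ord0).
  have jK : (j <= K)%N by rewrite -ltnS.
  have [lt|le] := ltnP t (K - j).
    rewrite big1 => [|a _]; last by rewrite (bin_small lt) !(mulr0n, mulr0).
    by case: eqP => [K0|_]; rewrite ?mul0rn //; exfalso; lia.
  transitivity (\sum_(a in A) weight A a * ((b + a) ^+ (m - j) * (b - a) ^+ (t - (K - j)))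
      *+ ('C(N + m, j) * 'C(t, K - j))).
    apply: eq_bigr => a _.
    by rewrite [X in _ * X]mulrnAr mulrnAl -mulrnA mulrnAr.
  rewrite sumrMnl sum_weight_monomial; last by lia.
  have [K0|K0] := eqVneq K 0%N.
    have j0 : j = ord0 by apply: val_inj => /=; lia.
    rewrite j0 K0 eqxx /= !bin0 !subn0 mulr1n.
    by rewrite [(m + t)%N]addnC.
  rewrite /= mulr0n mul0rn; case: eqP => [h|_]; last by rewrite mulr0n mul0rn.
  by exfalso; rewrite -h in tm; lia.
under eq_bigr do rewrite e.
by rewrite (bigD1 ord0) //= big1 ?addr0 ?eqxx ?mulr1n // => i /negPf->.
Qed.

(** For a other than [b] the factor (b + a)^N is 1, so the sum is the one without that factor, up to
    a correction from the diagonal term a = b. *)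
Lemma coef_stepanov A t m b K :
  (forall a, a \in A -> a != b -> (b + a) ^+ N = 1) ->
  (K <= m)%N -> (t + m < #|A|)%N ->
  (stepanov A t m \Po ('X + b%:P))`_K =
    (-1) ^+ t *+ ((K == 0%N) && ((t + m).+1 == #|A|)) +
    (weight A b * ((b + b) ^+ N - 1) * local_coef b t m K b) *+ (b \in A).
Proof.
move=> hb Km tm; rewrite coef_stepanov_shift -(sum_local_coef b Km tm).
have e a : \sum_(j < K.+1) ((b + a) ^+ (N + m - j) *+ 'C(N + m, j)) *
                    ((b - a) ^+ (t - (K - j)) *+ 'C(t, K - j)) =
    (b + a) ^+ N * local_coef b t m K a.
  rewrite mulr_sumr; apply: eq_bigr => j _; have jK : (j <= K)%N by rewrite -ltnS.
  have -> : (N + m - j = N + (m - j))%N by lia.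
  by rewrite exprD -mulrnAr mulrA.
under eq_bigr do rewrite e.
case: (boolP (b \in A)) => bA; rewrite ?mulr0n ?mulr1n ?addr0; last first.
  by apply: eq_bigr => a aA; rewrite hb ?mul1r //; apply: contraNneq bA => <-.
rewrite (bigD1 b) //= [in RHS](bigD1 b) //=.
rewrite (eq_bigr (fun a => weight A a * local_coef b t m K a)).
  by ring.
by move=> a /andP[aA ab]; rewrite hb ?mul1r.
Qed.

Lemma local_coef_diag0 b t m K : (K < t)%N -> local_coef b t m K b = 0.
Proof.
move=> Kt; apply: big1 => j _; rewrite subrr expr0n.
have -> : (t - (K - j) == 0)%N = false by lia.
by rewrite mul0rn mulr0.
Qed.

Lemma local_coef_diag b t m : local_coef b t m t b = (b + b) ^+ m.
Proof.
rewrite /local_coef big_ord_recl /= !subn0 subnn bin0 binn expr0 !mulr1n mulr1.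
rewrite big1 ?addr0 // => j _; rewrite subrr expr0n /= /bump /=.
have -> : (t - (t - (1 + j)) == 0)%N = false by have := ltn_ord j; lia.
by rewrite mul0rn mulr0.
Qed.

Lemma dvdp_comp_XaddC b p M : (forall K, (K < M)%N -> (p \Po ('X + b%:P))`_K = 0) ->
  ('X - b%:P) ^+ M %| p.
Proof.
move=> h; have e : p \Po ('X + b%:P) = drop_poly M (p \Po ('X + b%:P)) * 'X^M.
  rewrite -[LHS](poly_take_drop M); set t := take_poly _ _.
  suff -> : t = 0 by rewrite add0r.
  by apply/polyP => i; rewrite coef_take_poly coef0; case: ifP => // /h.
have -> : p = p \Po ('X + b%:P) \Po ('X - b%:P).
  by rewrite -comp_polyA comp_polyD comp_polyX comp_polyC subrK comp_polyXr.
by rewrite e rmorphM rmorphXn /= comp_polyX dvdp_mull.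
Qed.

(** The diagonal correction carries powers of b - b = 0 below order [t], and disappears altogether
    if (2b)^N = 1; the first case limits the multiplicity to [t]. *)
Lemma dvdp_stepanov A t m b M :
  (forall a, a \in A -> a != b -> (b + a) ^+ N = 1) ->
  (t + m < #|A|)%N -> (M <= m.+1)%N -> (b \in A -> (b + b) ^+ N != 1 -> (M <= t)%N) ->
  ('X - b%:P) ^+ M %| stepanov A t m - ((-1) ^+ t *+ ((t + m).+1 == #|A|))%:P.
Proof.
move=> hb tm Mm Mt; apply: dvdp_comp_XaddC => K KM.
rewrite comp_polyB comp_polyC coefB coefC coef_stepanov //; last by lia.
have -> : (weight A b * ((b + b) ^+ N - 1) * local_coef b t m K b) *+ (b \in A) = 0.
  case: (boolP (b \in A)) => // bA; have [->|ne] := eqVneq ((b + b) ^+ N) 1.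
    by rewrite subrr mulr0 mul0r mul0rn.
  by rewrite local_coef_diag0 ?mulr0 ?mul0rn // (leq_trans KM) ?Mt.
by rewrite addr0; case: eqP => _ /=; rewrite ?mulr0n subrr.
Qed.

Lemma sum_weight_exp A k : (k < #|A|)%N ->
  \sum_(a in A) weight A a * a ^+ k = (k.+1 == #|A|)%:R.
Proof.
move=> kA; have := @sum_weight_monomial F A 0 k 0; rewrite addn0 => /(_ kA) <-.
by apply: eq_bigr => a _; rewrite add0r expr0 mulr1.
Qed.

(** At the point 0 the relation a^N = 1 plays the part of (b + a)^N = 1: the coefficient of order K
    is a multiple of sum_a c_a a^(t + m - K), which is 0 for 0 < K < |A|. *)
Lemma dvdp_stepanov0 A t m : (forall a, a \in A -> a ^+ N = 1) ->
  (t + m).+1 = #|A| -> 'X^#|A| %| stepanov A t m - ((-1) ^+ t)%:P.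
Proof.
move=> hA tm; rewrite -['X]subr0 -polyC0; apply: dvdp_comp_XaddC => K KA.
rewrite comp_polyB comp_polyC coefB coefC coef_stepanov_shift.
transitivity (\sum_(a in A) weight A a * a ^+ (t + m - K) *
  (\sum_(j < K.+1) (-1) ^+ (t - (K - j)) *+ ('C(N + m, j) * 'C(t, K - j)))
  - (if K == 0%N then (-1) ^+ t else 0)).
  congr (_ - _); apply: eq_bigr => a aA; rewrite -mulrA; congr (_ * _).
  rewrite mulr_sumr; apply: eq_bigr => j _; have jK : (j <= K)%N by rewrite -ltnS.
  rewrite add0r sub0r mulrnAr [RHS]mulrnAr mulrnAl -mulrnA.
  have [lt|le] := ltnP t (K - j); first by rewrite (bin_small lt) muln0.
  have [lt|le'] := ltnP (N + m) j; first by rewrite (bin_small lt) mul0n.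
  congr (_ *+ _); rewrite (exprNn a) mulrCA -exprD [RHS]mulrC; congr (_ * _).
  have -> : (N + m - j + (t - (K - j)) = N + (t + m - K))%N by lia.
  by rewrite exprD hA ?mul1r.
rewrite -mulr_suml sum_weight_exp ?tm; last by rewrite -tm; lia.
rewrite -tm eqSS; have [K0|K0] := eqVneq K 0%N.
  rewrite K0 subn0 eqxx mul1r big_ord_recl big_ord0 !subn0 !bin0 mulr1n addr0.
  by rewrite subrr.
have -> : (t + m - K == t + m)%N = false by lia.
by rewrite mul0r subr0.
Qed.

Lemma coef_stepanovE A t m i : (i <= N + (t + m))%N ->
  (stepanov A t m)`_i = (\sum_(a in A) weight A a * a ^+ (N + (t + m) - i)) *
    \sum_(j < i.+1) (-1) ^+ (t - j) *+ ('C(t, j) * 'C(N + m, i - j)).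
Proof.
move=> le_i; rewrite coef_sum mulr_suml; apply: eq_bigr => a _.
rewrite coefZ -mulrA; congr (_ * _); rewrite -polyCN coefM mulr_sumr.
apply: eq_bigr => j _; have ji : (j <= i)%N by rewrite -ltnS.
rewrite !coef_XaddC_exp mulrnAr [RHS]mulrnAr mulrnAl -mulrnA.
have [lt|le] := ltnP t j; first by rewrite (bin_small lt) mul0n.
have [lt|le'] := ltnP (N + m) (i - j); first by rewrite (bin_small lt) muln0.
congr (_ *+ _); rewrite (exprNn a) -mulrA -exprD [RHS]mulrC; congr (_ * _ ^+ _); lia.
Qed.

(** The coefficient of X^i is a multiple of sum_a c_a a^(N + t + m - i), so the highest |A| - 1
    possible coefficients vanish. *)
Lemma size_stepanov A t m : (t + m < #|A|)%N ->
  (size (stepanov A t m) <= (N + (t + m)).+2 - #|A|)%N.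
Proof.
move=> tm; apply/leq_sizeP => i le_i; have [lt|ge] := ltnP (N + (t + m)) i.
  rewrite coef_sum big1 // => a _; rewrite coefZ coefM big1 ?mulr0 // => j _.
  rewrite -polyCN !coef_XaddC_exp; have ji : (j <= i)%N by rewrite -ltnS.
  have [lt1|le1] := ltnP t j; first by rewrite (bin_small lt1) mulr0n mul0r.
  by rewrite (@bin_small _ (i - j)) ?mulr0n ?mulr0 //; lia.
have A_gt0 : (0 < #|A|)%N by apply: leq_ltn_trans tm.
rewrite leq_subLR in le_i.
have lt : ((N + (t + m) - i).+1 < #|A|)%N by rewrite -subSn // ltn_subLR; lia.
by rewrite coef_stepanovE // sum_weight_exp ?(ltnW lt) // ltn_eqF ?mul0r.
Qed.

Lemma dvdp_prod_XsubC_exp A (e : F -> nat) p :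
  (forall b, b \in A -> ('X - b%:P) ^+ e b %| p) ->
  \prod_(b in A) ('X - b%:P) ^+ e b %| p.
Proof.
rewrite -big_enum => h.
have {h} : forall b, b \in enum A -> ('X - b%:P) ^+ e b %| p.
  by move=> b; rewrite mem_enum; apply: h.
elim: (enum A) (enum_uniq A) => [_ _|b s IHs /= /andP[bs us] h].
  by rewrite big_nil dvd1p.
rewrite big_cons Gauss_dvdp; last first.
  apply: coprimep_expl; elim: s bs {IHs us h} => [|c s IHs].
    by rewrite big_nil coprimep1.
  rewrite inE negb_or => /andP[bc bs]; rewrite big_cons coprimepMr IHs // andbT.
  by apply: coprimep_expr; rewrite coprimep_XsubC root_XsubC eq_sym.
by rewrite h ?mem_head // IHs // => c cs; rewrite h // inE cs orbT.
Qed.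

Lemma size_prod_XsubC_exp A (e : F -> nat) :
  size (\prod_(b in A) ('X - b%:P) ^+ e b) = (\sum_(b in A) e b).+1.
Proof.
rewrite size_prod => [|b _]; last by rewrite expf_neq0 ?polyXsubC_eq0.
under eq_bigr do rewrite size_exp_XsubC -addn1.
by rewrite big_split /= sum1_card -addSn addnK.
Qed.

Lemma sum_mult_lt_size A (e : F -> nat) p : p != 0 ->
  (forall b, b \in A -> ('X - b%:P) ^+ e b %| p) ->
  (\sum_(b in A) e b < size p)%N.
Proof.
move=> p0 /dvdp_prod_XsubC_exp/(dvdp_leq p0).
by rewrite size_prod_XsubC_exp.
Qed.

Lemma size_stepanov_subC A t m c : (t + m).+1 = #|A| ->
  (size (stepanov A t m - c%:P)%R <= N.+1)%N.
Proof.
move=> tm; apply: leq_trans (size_polyD _ _) _; rewrite size_polyN geq_max.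
rewrite (leq_trans (size_polyC_leq1 c)) // andbT.
have lt : (t + m < #|A|)%N by rewrite -tm.
by apply: leq_trans (size_stepanov lt) _; rewrite -tm; lia.
Qed.

(** The coefficient of order [t] at [b] reduces to the diagonal term c_b ((2b)^N - 1) (2b)^m. *)
Lemma stepanov_nonconst A t m b c : sums_in A -> b \in A -> b + b != 0 ->
  (b + b) ^+ N != 1 -> (0 < t <= m)%N -> (t + m < #|A|)%N -> stepanov A t m != c%:P.
Proof.
move=> hA bA bb bbN /andP[t0 tm] tmA; apply/eqP => e.
have hb a : a \in A -> a != b -> (b + a) ^+ N = 1.
  by move=> aA ab; apply: hA; rewrite // eq_sym.
have /esym/eqP := coef_stepanov hb tm tmA.
rewrite e comp_polyC coefC bA local_coef_diag (gtn_eqF t0) /= mulr0n add0r mulr1n.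
rewrite !mulf_eq0 expf_eq0 (negPf bb) andbF orbF.
by rewrite (negPf (weight_neq0 _ _)) subr_eq0 (negPf bbN).
Qed.

(** P_(T,T) minus its constant has degree at most [N], is nonzero because of [b], and has a zero of
    order [T] at each point of [A]. *)
Lemma card_odd_le A T b : sums_in A -> #|A| = T.*2.+1 -> (0 < T)%N -> b \in A ->
  b + b != 0 -> (b + b) ^+ N != 1 -> (T.*2.+1 * T <= N)%N.
Proof.
move=> hA cA T0 bA bb bbN; have TT : (T + T).+1 = #|A| by rewrite addnn cA.
rewrite -ltnS; apply: leq_trans (size_stepanov_subC ((-1) ^+ T) TT).
rewrite -cA -sum_nat_const; apply: sum_mult_lt_size.
  by rewrite subr_eq0 (stepanov_nonconst _ hA bA) // ?T0 ?leqnn // -TT.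
move=> a aA; have := @dvdp_stepanov A T T a T; rewrite TT eqxx mulr1n; apply=> // c cA' ca.
by apply: hA; rewrite // eq_sym.
Qed.

(* When [A] lies in the subgroup itself, [0] is an extra root of multiplicity [#|A|]. *)
Lemma card_odd_le0 A T b : sums_in A -> #|A| = T.*2.+1 -> (0 < T)%N -> b \in A ->
  b + b != 0 -> (b + b) ^+ N != 1 -> 0 \notin A -> (forall a, a \in A -> a ^+ N = 1) ->
  (T.*2.+1 * T.+1 <= N)%N.
Proof.
move=> hA cA T0 bA bb bbN A0 AN; have TT : (T + T).+1 = #|A| by rewrite addnn cA.
rewrite -ltnS; apply: leq_trans (size_stepanov_subC ((-1) ^+ T) TT).
have -> : (T.*2.+1 * T.+1 = \sum_(a in 0%R |: A) (if a == 0%R then #|A| else T))%N.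
  rewrite big_setU1 //= eqxx cA mulnS; congr (_ + _)%N.
  rewrite (eq_bigr (fun=> T)) ?sum_nat_const ?cA // => a aA.
  by case: eqP => // a0; rewrite -a0 aA in A0.
apply: sum_mult_lt_size.
  by rewrite subr_eq0 (stepanov_nonconst _ hA bA) // ?T0 ?leqnn // -TT.
move=> a; rewrite in_setU1; case: eqP => [-> _|_ /= aA].
  by rewrite subr0 dvdp_stepanov0.
have := @dvdp_stepanov A T T a T; rewrite TT eqxx mulr1n; apply=> // c cA' ca.
by apply: hA; rewrite // eq_sym.
Qed.

(** With the diagonal sums included, P_(0,m) built on m + 1 points of [A] equals 1 to order m + 1 at
    every point of [A]. Too many such points would make it constant, yet its coefficient of X^N is
    the given binomial. *)
Lemma card_full_le A m : (0 < N)%N -> (forall a b, a \in A -> b \in A -> (a + b) ^+ N = 1) ->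
  (m < #|A|)%N -> 'C(N + m, m)%:R != 0 :> F -> (#|A| * m.+1 <= N)%N.
Proof.
move=> N0 hA mA; apply: contraR; rewrite -ltnNge => lt_N.
have [A' sA' cA'] : exists2 A' : {set F}, A' \subset A & #|A'| = m.+1.
  exists [set x in take m.+1 (enum A)].
    by apply/fintype.subsetP => x; rewrite inE => /mem_take; rewrite mem_enum.
  rewrite cardsE (card_uniqP _) ?take_uniq ?enum_uniq //.
  by rewrite size_takel // -cardE.
have e : stepanov A' 0 m = 1%:P.
  apply/eqP; rewrite -subr_eq0; apply: contraLR lt_N => ne; rewrite -leqNgt -ltnS.
  apply: leq_trans (@size_stepanov_subC A' 0 m 1 _); last by rewrite cA'.
  rewrite -sum_nat_const; apply: sum_mult_lt_size ne _ => a aA.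
  have := @dvdp_stepanov A' 0 m a m.+1; rewrite cA' eqxx mulr1n; apply=> //.
    by move=> c cA1 _; rewrite hA // (fintype.subsetP sA').
  by move=> _; rewrite hA ?eqxx.
have := @coef_stepanovE A' 0 m N; rewrite add0n leq_addr => /(_ isT).
rewrite e coefC (gtn_eqF N0) addKn sum_weight_exp cA' // eqxx mul1r.
rewrite big_ord_recl bin0 mul1n subn0 big1 => [/esym/eqP|j _].
  by rewrite addr0 expr0 -(bin_sub (leq_addl N m)) addnK subn0.
by have -> : 'C(0, lift ord0 j) = 0%N by [].
Qed.

End Stepanov.

(** * Taylor coefficients at a point of the set *)

Section LocalRelation.
Variables (F : finFieldType) (N T : nat) (A : {set F}) (c b : F).
Hypothesis N_gt0 : (0 < N)%N.
Hypothesis hA : sums_in N A.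
Hypothesis hT : (T.*2 <= #|A|)%N.
Hypothesis hc : stepanov N A T T.-1 = c%:P.
Hypothesis bA : b \in A.
Hypothesis bb : b + b != 0.

Let W := (N + T.-1)%N.

Lemma oppr_notin : - b \notin A.
Proof.
apply: contra bb => mbA; have [bmb|ne] := eqVneq b (- b).
  by rewrite {2}bmb subrr.
have /eqP := hA bA mbA ne.
by rewrite subrr expr0n gtn_eqF // eq_sym oner_eq0.
Qed.

Lemma addr_neq0_in a : a \in A -> b + a != 0.
Proof.
by move=> aA; apply: contraNneq oppr_notin => /eqP; rewrite addrC addr_eq0 => /eqP <-.
Qed.

(** This says that the Taylor coefficient of order [T + e] at [b] of a constant is 0. Terms with at
    least [T] derivatives on (X + a)^W leave negative powers of b + a once (b + a)^N is removed; the
    other terms sum to 0, and a = b needs a correction. *)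
Lemma local_relation e : (e < T)%N ->
  \sum_(f < e.+1) ('C(W, T + f) * 'C(T, e - f))%:R *
     (\sum_(a in A) weight A a * ((b - a) ^+ (T - (e - f)) / (b + a) ^+ f.+1))
  + weight A b * ((b + b) ^+ N - 1) * ((b + b) ^+ (T.-1 - e) * 'C(W, e)%:R) = 0.
Proof.
move=> eT; pose lo (j : nat) a := (b + a) ^+ (T.-1 - j) *
  (b - a) ^+ (T - (T + e - j)) * ('C(W, j) * 'C(T, T + e - j))%:R.
pose hi (f : nat) a := (b - a) ^+ (T - (e - f)) / (b + a) ^+ f.+1 *
   ('C(W, T + f) * 'C(T, e - f))%:R.
pose tau a := \sum_(j < T) lo j a + \sum_(f < e.+1) hi f a.
have coefE : 0 = \sum_(a in A) weight A a * ((b + a) ^+ N * tau a).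
  have := @coef_stepanov_shift F N A T T.-1 b (T + e).
  rewrite hc comp_polyC coefC; case: eqP => [|_ h0]; first by lia.
  apply: etrans h0 _; apply: eq_bigr => a aA; congr (_ * _); rewrite -addnS big_split_ord /= mulrDr.
  congr (_ + _); rewrite mulr_sumr; apply: eq_bigr => j _ /=.
    have jT := ltn_ord j; rewrite mulrnAr mulrnAl -mulrnA /lo mulr_natr.
    have -> : (N + T.-1 - j = N + (T.-1 - j))%N by lia.
    by rewrite exprD [RHS]mulrnAr !mulrA.
  have -> : (T + e - (T + j) = e - j)%N by lia.
  rewrite mulrnAr mulrnAl -mulrnA /hi mulr_natr !mulrnAr; rewrite -/W.
  have [lt|le] := ltnP W (T + j); first by rewrite (bin_small lt) !mul0n !mulr0n.
  congr (_ *+ _); have -> : (b + a) ^+ N = (b + a) ^+ (W - (T + j)) * (b + a) ^+ j.+1.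
    by rewrite -exprD; congr (_ ^+ _); rewrite /W in le *; lia.
  by field; rewrite expf_neq0 ?addr_neq0_in.
(* At a = b a positive power of b - a kills the terms j > e, and the binomial coefficient kills
   those with j < e. *)
have taub : tau b = (b + b) ^+ (T.-1 - e) * 'C(W, e)%:R.
  rewrite /tau [X in _ + X]big1 => [|f _]; last first.
    rewrite /hi subrr expr0n; have -> : (T - (e - f) == 0)%N = false by lia.
    by rewrite !mul0r.
  rewrite addr0 (bigD1 (Ordinal eT)) //= big1 => [|j je].
    rewrite /lo addnK subnn binn muln1 expr0 mulr1 addr0 //.
  rewrite /lo subrr expr0n; have [le|lt] := leqP j e; last first.
    have -> : (T - (T + e - j) == 0)%N = false by have := ltn_ord j; lia.
    by rewrite mulr0 mul0r.
  rewrite (@bin_small T) ?muln0 ?mulr0 //.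
  by move: je; rewrite -val_eqE /=; lia.
(* The exponents of b + a and b - a add up to T - 1 - e, which is below |A| - 1. *)
have lo0 : \sum_(a in A) weight A a * \sum_(j < T) lo j a = 0.
  under eq_bigr do rewrite mulr_sumr.
  rewrite exchange_big /= big1 // => j _; have jT := ltn_ord j.
  have [lt|le] := ltnP j e.
    by apply: big1 => a _; rewrite /lo (@bin_small T) ?muln0 ?mulr0 //; lia.
  under eq_bigr do rewrite /lo mulrA.
  rewrite -mulr_suml sum_weight_monomial; last by apply: leq_trans hT; lia.
  case: eqP => [h|_]; last by rewrite mulr0n mul0r.
  by exfalso; have := hT; rewrite -h; lia.
rewrite -taub; have -> : \sum_(f < e.+1) ('C(W, T + f) * 'C(T, e - f))%:R *
     (\sum_(a in A) weight A a * ((b - a) ^+ (T - (e - f)) / (b + a) ^+ f.+1))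
   = \sum_(a in A) weight A a * tau a.
  under [RHS]eq_bigr do rewrite /tau mulrDr.
  rewrite big_split /= lo0 add0r; under [RHS]eq_bigr do rewrite mulr_sumr.
  rewrite exchange_big /=; apply: eq_bigr => f _; rewrite mulr_sumr.
  by apply: eq_bigr => a _; rewrite /hi [LHS]mulrC -[LHS]mulrA.
apply: etrans (esym coefE); rewrite (bigD1 b) //= [in RHS](bigD1 b) //=.
rewrite [in RHS](eq_bigr (fun a => weight A a * tau a)); first by ring.
by move=> a /andP[aA ab]; rewrite hA ?mul1r // eq_sym.
Qed.

Hypothesis T_gt2 : (2 < T)%N.

Let S := weighted_sum A b.
Let f i := (set_poly A \Po ('X - b%:P))`_i.
Let B i : F := 'C(W, T + i)%:R.
Let gamma := weight A b * ((b + b) ^+ N - 1).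

Lemma card_gt_T : (T < #|A|)%N.
Proof. by apply: leq_trans hT; have := T_gt2; lia. Qed.

(** Write b - a = 2b - (b + a) and expand in powers of b + a. *)
Lemma sum_weight_div k e : (k <= T)%N ->
  \sum_(a in A) weight A a * ((b - a) ^+ k / (b + a) ^+ e.+1) =
  \sum_(i < e.+1) (-1) ^+ i * 'C(k, i)%:R * (b + b) ^+ (k - i) * S (e - i).
Proof.
move=> kT; pose q : {poly F} := (-1) ^+ k *: ('X + (- (b + b))%:P) ^+ k.
have qE a : q.[b + a] = (b - a) ^+ k.
  rewrite hornerZ horner_exp hornerD hornerX hornerC -exprMn; congr (_ ^+ _); ring.
under eq_bigr do rewrite -qE.
have A_gt := card_gt_T.
have sq : (size q <= #|A| + e.+1)%N.
  apply: leq_trans (size_scale_leq _ _) _; rewrite polyCN size_exp_XsubC.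
  by apply: leq_trans (leq_addr _ _); apply: leq_ltn_trans kT A_gt.
rewrite weighted_sum_horner // ?oppr_notin //; last by apply: leq_ltn_trans A_gt.
have qi i : q`_i = (-1) ^+ i * 'C(k, i)%:R * (b + b) ^+ (k - i).
  rewrite coefZ coef_XaddC_exp; have [lt|le] := ltnP k i.
    by rewrite bin_small // mulr0n !mulr0 mul0r.
  rewrite (exprNn (b + b)) -mulr_natr -signr_odd -[(-1) ^+ (k - i)]signr_odd.
  rewrite -[(-1) ^+ i]signr_odd oddB //; case: (odd k); case: (odd i) => /=;
  rewrite ?expr0 ?expr1; ring.
rewrite [q`_(#|A| + e)]qi bin_small ?mulr0 ?mul0r ?addr0.
  by apply: eq_bigr => i _; rewrite qi.
by apply: leq_trans (leq_addr _ _); apply: leq_ltn_trans kT A_gt.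
Qed.

Lemma weighted_sum_rel0 : f 0 * S 0 = -1.
Proof.
have := @weighted_sum_comp F A b 0 oppr_notin; rewrite (leq_ltn_trans _ card_gt_T) //.
by move=> /(_ isT); rewrite big_ord_recl big_ord0 addr0.
Qed.

Lemma weighted_sum_rel1 : f 0 * S 1 + f 1 * S 0 = 0.
Proof.
have := @weighted_sum_comp F A b 1 oppr_notin; rewrite (leq_ltn_trans _ card_gt_T) //.
by move=> /(_ isT); rewrite !big_ord_recl big_ord0 addr0 oppr0.
Qed.

Lemma weighted_sum_rel2 : f 0 * S 2 + f 1 * S 1 + f 2 * S 0 = 0.
Proof.
have := @weighted_sum_comp F A b 2 oppr_notin; rewrite (leq_ltn_trans _ card_gt_T) //.
by move=> /(_ isT); rewrite !big_ord_recl big_ord0 addr0 oppr0 addrA.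
Qed.

Lemma comp0_neq0 : f 0 != 0.
Proof.
apply/eqP => f0; have /eqP := weighted_sum_rel0.
by rewrite f0 mul0r eq_sym oppr_eq0 oner_eq0.
Qed.

(** Order [T], with (2b)^(T-1) cancelled. The next two lemmas do the same for orders T + 1 and T +
    2, cancelling (2b)^(T-2) and (2b)^(T-3). *)
Lemma local_relation0 : B 0 * (b + b) * S 0 + gamma = 0.
Proof.
have := @local_relation 0 (leq_trans (isT : (0 < 3)%N) T_gt2).
rewrite big_ord_recl big_ord0 addr0 /= !subn0 sum_weight_div // big_ord_recl big_ord0.
rewrite !subn0 !bin0 muln1 addr0 mulr1 expr0 !mul1r -/gamma => h.
apply: (mulIf (expf_neq0 T.-1 bb)); rewrite mul0r -[RHS]h /B.
have -> : (b + b) ^+ T = (b + b) ^+ T.-1 * (b + b).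
  by rewrite -exprSr prednK //; apply: leq_trans T_gt2.
by rewrite addn0; ring.
Qed.

Lemma local_relation1 :
  B 0 * T%:R * (b + b) * S 0 + B 1 * ((b + b) ^+ 2 * S 1 - T%:R * (b + b) * S 0)
  + gamma * W%:R = 0.
Proof.
have := @local_relation 1 (leq_trans (isT : (1 < 3)%N) T_gt2).
rewrite !big_ord_recl big_ord0 addr0 /= /bump /= !subn0.
rewrite !sum_weight_div ?leq_subr // !big_ord_recl !big_ord0 /= /bump /=.
rewrite !addn0 !subn0 !bin0 !bin1 !addr0 expr0 expr1 -/gamma => h.
have [k ek] : exists k, T = k.+3 by exists (T - 3)%N; have := T_gt2; lia.
apply: (mulIf (expf_neq0 k.+1 bb)); rewrite mul0r -[RHS]h /B addn0.
have -> : (T - 1 = k.+2)%N by lia.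
have -> : (T.-1 - 1 = k.+1)%N by lia.
have -> : (b + b) ^+ T = (b + b) ^+ k.+1 * (b + b) ^+ 2 by rewrite -exprD ek addn2.
rewrite (exprSr _ k.+1) !natrM; ring.
Qed.

Lemma local_relation2 :
  B 0 * 'C(T, 2)%:R * (b + b) * S 0
  + B 1 * T%:R * ((b + b) ^+ 2 * S 1 - (T%:R - 1) * (b + b) * S 0)
  + B 2 * ((b + b) ^+ 3 * S 2 - T%:R * (b + b) ^+ 2 * S 1 + 'C(T, 2)%:R * (b + b) * S 0)
  + gamma * 'C(W, 2)%:R = 0.
Proof.
have := @local_relation 2 T_gt2.
rewrite !big_ord_recl big_ord0 addr0 /= /bump /= !subn0.
rewrite !sum_weight_div ?leq_subr // !big_ord_recl !big_ord0 /= /bump /=.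
rewrite !addn0 !subn0 !bin0 !bin1 !addr0 expr0 expr1 -/gamma => h.
have [k ek] : exists k, T = k.+3 by exists (T - 3)%N; have := T_gt2; lia.
apply: (mulIf (expf_neq0 k bb)); rewrite mul0r -[RHS]h /B addn0.
have -> : (T - 1 = k.+2)%N by lia.
have -> : (T - 2 = k.+1)%N by lia.
have -> : (T.-1 - 2 = k)%N by lia.
have -> : (b + b) ^+ T = (b + b) ^+ k * (b + b) ^+ 3 by rewrite -exprD ek addn3.
have -> : (T%:R - 1 = k.+2%:R :> F) by rewrite ek -natr1 addrK.
rewrite !exprS !natrM; ring.
Qed.

Hypothesis N_gt2 : (2 < N)%N.
Hypothesis B_neq0 : B 0 != 0.
Hypothesis N_neq1 : N%:R - 1 != 0 :> F.

Lemma bin_rel i : (i < N)%N -> B i.+1 * (T + i).+1%:R = B i * (N - i.+1)%:R.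
Proof.
move=> iN; rewrite /B -!natrM addnS mulnC mul_bin_left mulnC; congr (_ * _)%:R.
by rewrite /W; have := T_gt2; lia.
Qed.

Lemma bin_rel0 : B 1 * (T%:R + 1) = B 0 * (N%:R - 1).
Proof. by have := bin_rel N_gt0; rewrite addn0 -natr1 natrB. Qed.

Lemma bin_rel1 : B 2 * (T%:R + 2) = B 1 * (N%:R - 2).
Proof.
have := @bin_rel 1 (ltn_trans (isT : (1 < 2)%N) N_gt2).
by rewrite addn1 -[T.+2]addn2 natrD natrB // (ltn_trans _ N_gt2).
Qed.

(** Eliminating [gamma] between orders [T] and T + 1 gives the logarithmic derivative of
    [set_poly A] at [- b], since S 1 / S 0 = - f 1 / f 0 and B 1 / B 0 = (N - 1) / (T + 1). *)
Lemma comp_slope : f 1 * (b + b) = - (2 * T%:R + 1) * f 0.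
Proof.
have r0 := local_relation0; have r1 := local_relation1.
have g : gamma = - (B 0 * (b + b) * S 0) by apply/eqP; rewrite -addr_eq0 addrC r0.
have w0 := weighted_sum_rel0; have w1 := weighted_sum_rel1; have b0 := bin_rel0.
have WE : W%:R = N%:R + T%:R - 1 :> F.
  by rewrite /W natrD -subn1 natrB ?addrA //; apply: ltn_trans T_gt2.
have B1 : B 1 != 0.
  apply/eqP => h; have /eqP := bin_rel0; rewrite h mul0r eq_sym mulf_eq0.
  by rewrite (negPf B_neq0) (negPf N_neq1).
apply: (mulfI B1); apply: (mulfI bb); apply/eqP; rewrite -subr_eq0; apply/eqP.
have e1 : f 0 * S 1 = - (f 1 * S 0) by apply/eqP; rewrite -addr_eq0 w1.
transitivity (f 0 * f 0 * (B 0 * T%:R * (b + b) * S 0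
   + B 1 * ((b + b) ^+ 2 * S 1 - T%:R * (b + b) * S 0) + gamma * W%:R)); last first.
  by rewrite r1 mulr0.
rewrite g WE; apply/esym.
transitivity (f 0 * (B 0 * T%:R * (b + b) * (f 0 * S 0)
   + B 1 * ((b + b) ^+ 2 * (f 0 * S 1) - T%:R * (b + b) * (f 0 * S 0))
   - B 0 * (b + b) * (f 0 * S 0) * (N%:R + T%:R - 1))); first by ring.
rewrite e1.
transitivity (f 0 * (b + b) * (f 0 * S 0) *
     (B 0 * T%:R - B 1 * T%:R - B 0 * (N%:R + T%:R - 1))
   - B 1 * (b + b) ^+ 2 * f 1 * (f 0 * S 0)); first by ring.
rewrite w0.
transitivity (f 0 * (b + b) * (B 1 * T%:R + B 0 * (N%:R - 1)) + B 1 * (b + b) ^+ 2 * f 1).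
  by ring.
by rewrite -b0; ring.
Qed.

(** The relation of order T + 2 after every S i is expressed through [S 0] and [r], so that only
    [N], [T] and [r] remain. *)
Lemma comp_curvature r : f 2 * (b + b) ^+ 2 = r * f 0 ->
  (T%:R + 1) * (T%:R + 2) * (T%:R * (T%:R - 1))
  + 2 * (N%:R - 1) * (T%:R + 2) * T%:R * (T%:R + 2)
  + (N%:R - 1) * (N%:R - 2) *
      (2 * (2 * T%:R + 1) * (T%:R + 1) - 2 * r + T%:R * (T%:R - 1))
  - (T%:R + 1) * (T%:R + 2) * ((N%:R + T%:R - 1) * (N%:R + T%:R - 2)) = 0 :> F.
Proof.
move=> f2; have r0 := local_relation0; have r2 := local_relation2.
have g : gamma = - (B 0 * (b + b) * S 0) by apply/eqP; rewrite -addr_eq0 addrC r0.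
have w0 := weighted_sum_rel0; have w1 := weighted_sum_rel1; have w2 := weighted_sum_rel2.
have b0 := bin_rel0; have b1 := bin_rel1; have sl := comp_slope.
have f0 := comp0_neq0.
have S0 : S 0 != 0 by apply: contra_eq_neq w0 => ->; rewrite mulr0 eq_sym oppr_eq0 oner_eq0.
have c1 : S 1 * (b + b) = (2 * T%:R + 1) * S 0.
  apply: (mulfI f0); transitivity ((f 0 * S 1 + f 1 * S 0) * (b + b) - f 1 * (b + b) * S 0).
    by ring.
  by rewrite w1 sl; ring.
have c2 : S 2 * (b + b) ^+ 2 = ((2 * T%:R + 1) ^+ 2 - r) * S 0.
  apply: (mulfI f0).
  transitivity ((f 0 * S 2 + f 1 * S 1 + f 2 * S 0) * (b + b) ^+ 2
     - f 1 * (b + b) * (S 1 * (b + b)) - f 2 * (b + b) ^+ 2 * S 0); first by ring.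
  by rewrite w2 sl f2 c1; ring.
have WE : W%:R = N%:R + T%:R - 1 :> F.
  by rewrite /W natrD -subn1 natrB ?addrA //; apply: ltn_trans T_gt2.
have dbl k : (0 < k)%N -> 2 * 'C(k, 2)%:R = k%:R * (k%:R - 1) :> F.
  by move=> k0; rewrite -natrM mul_bin_left bin1 natrM natrB // mulrC.
have dT := dbl T (ltn_trans (isT : (0 < 2)%N) T_gt2).
have dW : 2 * 'C(W, 2)%:R = (N%:R + T%:R - 1) * (N%:R + T%:R - 2) :> F.
  by rewrite dbl ?WE; [ring | rewrite /W; have := N_gt0; lia].
apply: (mulfI (mulf_neq0 (mulf_neq0 B_neq0 bb) S0)); rewrite mulr0.
(* This factor clears the denominators of the binomials C(T,2), C(W,2) and of the ratios B 1 / B 0,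
   B 2 / B 0. *)
transitivity (2 * (T%:R + 1) * (T%:R + 2) * (
  B 0 * 'C(T, 2)%:R * (b + b) * S 0
  + B 1 * T%:R * ((b + b) ^+ 2 * S 1 - (T%:R - 1) * (b + b) * S 0)
  + B 2 * ((b + b) ^+ 3 * S 2 - T%:R * (b + b) ^+ 2 * S 1 + 'C(T, 2)%:R * (b + b) * S 0)
  + gamma * 'C(W, 2)%:R)); last by rewrite r2 mulr0.
have -> : (b + b) ^+ 2 * S 1 = (b + b) * ((2 * T%:R + 1) * S 0) by rewrite -c1; ring.
have -> : (b + b) ^+ 3 * S 2 = (b + b) * (((2 * T%:R + 1) ^+ 2 - r) * S 0).
  by rewrite -c2; ring.
have -> : T%:R * (b + b) ^+ 2 * S 1 = T%:R * ((b + b) * ((2 * T%:R + 1) * S 0)).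
  by rewrite -c1; ring.
rewrite g.
transitivity ((b + b) * S 0 * (
  (T%:R + 1) * (T%:R + 2) * B 0 * (2 * 'C(T, 2)%:R)
  + 2 * (T%:R + 2) * (B 1 * (T%:R + 1)) * T%:R * (T%:R + 2)
  + (B 2 * (T%:R + 2)) * (T%:R + 1) * (2 * (2 * T%:R + 1) * (T%:R + 1) - 2 * r + 2 * 'C(T, 2)%:R)
  - (T%:R + 1) * (T%:R + 2) * B 0 * (2 * 'C(W, 2)%:R))); last by ring.
rewrite dT dW b1.
transitivity ((b + b) * S 0 * (
  (T%:R + 1) * (T%:R + 2) * B 0 * (T%:R * (T%:R - 1))
  + 2 * (T%:R + 2) * (B 1 * (T%:R + 1)) * T%:R * (T%:R + 2)
  + (B 1 * (T%:R + 1)) * (N%:R - 2) * (2 * (2 * T%:R + 1) * (T%:R + 1) - 2 * r + T%:R * (T%:R - 1))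
  - (T%:R + 1) * (T%:R + 2) * B 0 * ((N%:R + T%:R - 1) * (N%:R + T%:R - 2)))); last by ring.
by rewrite b0; ring.
Qed.

End LocalRelation.

(** * Consequences of a constant Stepanov polynomial *)

Section ConstantStepanov.
Variables (F : finFieldType) (N T : nat) (A : {set F}) (c : F).
Hypothesis two_neq0 : 2 != 0 :> F.
Hypothesis N_gt2 : (2 < N)%N.
Hypothesis hA : sums_in N A.
Hypothesis T_gt2 : (2 < T)%N.
Hypothesis hT : (T.*2 <= #|A|)%N.
Hypothesis hc : stepanov N A T T.-1 = c%:P.

Let phi := set_poly A.
Let phim := (-1) ^+ #|A| *: (phi \Po - 'X).
Let B : F := 'C(N + T.-1, T)%:R.
Let N_gt0 : (0 < N)%N := ltn_trans (isT : (0 < 2)%N) N_gt2.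

Lemma addrr_neq0 (b : F) : b != 0 -> b + b != 0.
Proof. by move=> b0; rewrite -mulr2n -mulr_natr mulf_neq0. Qed.

Lemma coef_shift0 (b : F) : (phi \Po ('X - b%:P))`_0 = phi.[- b].
Proof. by rewrite -horner_coef0 horner_comp !hornerE ?sub0r. Qed.

Lemma coef_shift1 (b : F) : (phi \Po ('X - b%:P))`_1 = phi^`().[- b].
Proof.
rewrite -[_`_1]mulr1n -coef_deriv -horner_coef0 deriv_comp derivXsubC mulr1.
by rewrite horner_comp !hornerE ?sub0r.
Qed.

Lemma coef_shift2 (b : F) : 2 * (phi \Po ('X - b%:P))`_2 = phi^`()^`().[- b].
Proof.
rewrite mulr_natl -coef_deriv deriv_comp derivXsubC mulr1.
rewrite -[_`_1]mulr1n -coef_deriv -horner_coef0 deriv_comp derivXsubC mulr1.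
by rewrite horner_comp !hornerE ?sub0r.
Qed.

Lemma horner_phi_opp b : b \in A -> b != 0 -> phi.[- b] != 0.
Proof.
by move=> bA b0; rewrite -/(root _ _) root_set_poly (oppr_notin N_gt0 hA) ?addrr_neq0.
Qed.

(** The relation of order [T] with its unknowns made explicit: c_b is 1 / phi'(b) and the weighted
    sum of order 0 is -1 / phi(-b). *)
Lemma diag_relation b : b \in A -> b != 0 ->
  ((b + b) ^+ N - 1) * phi.[- b] = B * ((b + b) * phi^`().[b]).
Proof.
move=> bA b0; have bb := addrr_neq0 b0.
have := local_relation0 N_gt0 hA hT hc bA bb T_gt2.
have := weighted_sum_rel0 N_gt0 hA hT bA bb T_gt2.
rewrite addn0 -/B coef_shift0 weight_deriv // => e1 e2.
have d0 : phi^`().[b] != 0.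
  by have := weight_neq0 A b; rewrite weight_deriv // invr_eq0.
apply: (mulfI (invr_neq0 d0)).
set S := weighted_sum _ _ _ in e1 e2.
transitivity ((B * (b + b) * S + phi^`().[b]^-1 * ((b + b) ^+ N - 1)) * phi.[- b]
  - B * (b + b) * (phi.[- b] * S)); first by ring.
by rewrite e1 e2; field.
Qed.

Lemma diag_trivial : B = 0 -> forall b, b \in A -> b != 0 -> (b + b) ^+ N = 1.
Proof.
move=> B0 b bA b0; have /eqP := diag_relation bA b0.
rewrite B0 mul0r mulf_eq0 (negPf (horner_phi_opp bA b0)) orbF subr_eq0.
by move/eqP.
Qed.

Hypothesis B_neq0 : B != 0.
Hypothesis N_neq1 : N%:R - 1 != 0 :> F.

Lemma diag_nontrivial b : b \in A -> b != 0 -> (b + b) ^+ N != 1.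
Proof.
move=> bA b0; have := horner_phi_opp bA b0; have := addrr_neq0 b0.
have /eqP := diag_relation bA b0.
have d0 : phi^`().[b] != 0.
  by have := weight_neq0 A b; rewrite weight_deriv // invr_eq0.
move=> e bb0 p0; apply: contraTneq e => ->.
by rewrite subrr mul0r eq_sym !mulf_neq0.
Qed.

Let rho : F := 2 * #|A|%:R - 2 * T%:R - 1.

Lemma horner_phim x : phim.[x] = (-1) ^+ #|A| * phi.[- x].
Proof. by rewrite hornerZ horner_comp hornerN hornerX. Qed.

(** Both sides vanish on - A, the left one by [comp_slope]; [rho] is chosen so that their
    coefficients of degree |A| agree, and |A| common roots then force equality. *)
Lemma derivative_relation :
  2 *: ('X * phi^`()) - (2 * T%:R + 1) *: phi = rho *: phim.
Proof.
have sphi : size phi = #|A|.+1 by apply: size_set_poly.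
have mphi : phi`_#|A| = 1 by have /monicP := monic_set_poly A; rewrite /lead_coef sphi.
have sm : size phim = #|A|.+1.
  rewrite size_scale ?expf_neq0 ?oppr_eq0 ?oner_eq0 // size_comp_poly2 //.
  by rewrite size_polyN size_polyX.
have mm : phim`_#|A| = 1.
  have -> : phim`_#|A| = lead_coef phim by rewrite /lead_coef sm.
  rewrite lead_coefZ lead_coef_comp ?size_polyN ?size_polyX //.
  have /monicP -> := monic_set_poly A.
  rewrite lead_coefN lead_coefX sphi mul1r -exprMn mulrNN mulr1.
  by rewrite expr1n.
apply/eqP; rewrite -subr_eq0; apply/eqP; set D := _ - _.
have DE x : D.[x] = 2 * (x * phi^`().[x]) - (2 * T%:R + 1) * phi.[x]
    - rho * ((-1) ^+ #|A| * phi.[- x]).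
  rewrite /D !hornerD !hornerN (hornerZ 2) hornerM hornerX (hornerZ rho).
  by rewrite horner_phim hornerZ.
apply: (@roots_geq_poly_eq0 _ D [seq - a | a <- enum A]).
- apply/allP => x /mapP[a]; rewrite mem_enum => aA ->.
  have pa : phi.[a] = 0 by apply/rootP; rewrite root_set_poly.
  rewrite rootE DE opprK pa !mulr0 subr0; have [a0|a0] := eqVneq a 0.
    by rewrite a0 oppr0 mul0r mulr0 -a0 pa mulr0 subr0.
  have bb := addrr_neq0 a0.
  have := comp_slope N_gt0 hA hT hc aA bb T_gt2 N_gt2.
  rewrite addn0 coef_shift0 coef_shift1 => /(_ B_neq0 N_neq1) e.
  apply/eqP; transitivity (- (phi^`().[- a] * (a + a)) - (2 * T%:R + 1) * phi.[- a]).
    by ring.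
  by rewrite e; ring.
- by rewrite map_inj_uniq ?enum_uniq //; apply: oppr_inj.
rewrite size_map -cardE; apply/leq_sizeP => i; rewrite leq_eqVlt => /orP[/eqP<-|lt].
  rewrite /D !coefB (coefZ 2) coefXM coef_deriv (coefZ rho) mm coefZ mphi.
  case: ifP => [/eqP n0|/negbT n0]; last first.
    by rewrite prednK ?lt0n // mphi /rho; ring.
  by have := hT; rewrite n0; have := T_gt2; lia.
rewrite /D !coefB (coefZ 2) coefXM coef_deriv (coefZ rho) coefZ.
rewrite gtn_eqF ?(leq_ltn_trans _ lt) // prednK ?(leq_ltn_trans _ lt) //.
by rewrite !(nth_default _ (leq_trans _ lt)) ?sphi ?sm // mul0rn !mulr0 !subr0.
Qed.

Lemma derivative_relation_horner x :
  2 * (x * phi^`().[x]) = (2 * T%:R + 1) * phi.[x] + rho * ((-1) ^+ #|A| * phi.[- x]).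
Proof.
have := congr1 (fun p => p.[x]) derivative_relation.
rewrite hornerD hornerN (hornerZ 2) hornerM hornerX (hornerZ rho) horner_phim hornerZ.
by move=> <-; ring.
Qed.

Lemma diag_constant b : b \in A -> b != 0 ->
  (b + b) ^+ N = 1 + B * rho * (-1) ^+ #|A|.
Proof.
move=> bA b0; apply: (mulIf (horner_phi_opp bA b0)).
have e := diag_relation bA b0.
have pb : phi.[b] = 0 by apply/rootP; rewrite root_set_poly.
have := derivative_relation_horner b; rewrite pb mulr0 add0r => e'.
transitivity (((b + b) ^+ N - 1) * phi.[- b] + phi.[- b]); first by ring.
have -> : ((b + b) ^+ N - 1) * phi.[- b] = B * (2 * (b * phi^`().[b])).
  by rewrite e; ring.
by rewrite e'; ring.
Qed.

(** Differentiate [derivative_relation] at [- b], then remove phi'(b) and phi'(-b) by the relation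
    itself at [b] and [- b]; using [rho] twice gives its square. *)
Lemma derivative_relation_horner1 b : b \in A -> b != 0 ->
  (b + b) ^+ 2 * phi^`()^`().[- b] = (rho ^+ 2 + 4 * T%:R ^+ 2 - 1) * phi.[- b].
Proof.
move=> bA b0; have pb : phi.[b] = 0 by apply/rootP; rewrite root_set_poly.
have e1 := derivative_relation_horner b; rewrite pb mulr0 add0r in e1.
have e2 := derivative_relation_horner (- b).
rewrite opprK pb !mulr0 addr0 in e2.
have := congr1 (fun p => p^`().[- b]) derivative_relation.
rewrite derivB !derivZ derivM derivX mul1r deriv_comp derivN derivX.
rewrite !(hornerD, hornerN, hornerZ, hornerM, horner_comp, hornerX, hornerC) opprK => e3.
have s2 : (-1) ^+ #|A| * (-1) ^+ #|A| = 1 :> F by rewrite -exprMn mulrNN mulr1 expr1n.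
transitivity (- (2 * b) * (2 * (phi^`().[- b] + - b * phi^`()^`().[- b]) -
    (2 * T%:R + 1) * phi^`().[- b]) - (1 - 2 * T%:R) * (2 * (- b * phi^`().[- b]))).
  by ring.
rewrite e3 e2.
transitivity (rho * (-1) ^+ #|A| * (2 * (b * phi^`().[b])) +
  (4 * T%:R ^+ 2 - 1) * phi.[- b]); first by ring.
rewrite e1.
transitivity (rho ^+ 2 * ((-1) ^+ #|A| * (-1) ^+ #|A|) * phi.[- b] +
  (4 * T%:R ^+ 2 - 1) * phi.[- b]); first by ring.
by rewrite s2; ring.
Qed.

Lemma curvature_relation b r : b \in A -> b != 0 ->
  2 * r = rho ^+ 2 + 4 * T%:R ^+ 2 - 1 ->
  (T%:R + 1) * (T%:R + 2) * (T%:R * (T%:R - 1))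
  + 2 * (N%:R - 1) * (T%:R + 2) * T%:R * (T%:R + 2)
  + (N%:R - 1) * (N%:R - 2) *
      (2 * (2 * T%:R + 1) * (T%:R + 1) - 2 * r + T%:R * (T%:R - 1))
  - (T%:R + 1) * (T%:R + 2) * ((N%:R + T%:R - 1) * (N%:R + T%:R - 2)) = 0 :> F.
Proof.
move=> bA b0 er; apply: (comp_curvature N_gt0 hA hT hc bA (addrr_neq0 b0)) => //.
  by rewrite addn0.
apply: (mulfI two_neq0); rewrite coef_shift0 mulrA coef_shift2 [LHS]mulrC.
by rewrite derivative_relation_horner1 // -er; ring.
Qed.

Lemma curvature_even b : b \in A -> b != 0 -> #|A| = T.*2 ->
  T%:R * ((T%:R + 2) - (2 * T%:R - 3) * (N%:R - 2)) = 0 :> F.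
Proof.
move=> bA b0 cA; apply: (mulfI two_neq0); apply: (mulfI N_neq1); rewrite !mulr0.
(* Here [rho] is 2T - 1, so r = (rho^2 + 4T^2 - 1) / 2 is 2T(2T - 1); the relation then splits off
   the factor 2(N - 1). *)
have := @curvature_relation b (2 * T%:R * (2 * T%:R - 1)) bA b0.
rewrite /rho cA -mul2n natrM => /(_ _) <-; ring.
Qed.

Lemma curvature_odd b : b \in A -> b != 0 -> #|A| = T.*2.+1 ->
  T%:R * ((T%:R + 2) - (2 * T%:R + 1) * (N%:R - 2)) = 0 :> F.
Proof.
move=> bA b0 cA; apply: (mulfI two_neq0); apply: (mulfI N_neq1); rewrite !mulr0.
have := @curvature_relation b (2 * T%:R * (2 * T%:R + 1)) bA b0.
rewrite /rho cA -mul2n [(2 * T).+1%:R]mulrSr natrM => /(_ _) <-; ring.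
Qed.

(* For [0 \notin A], compare both sides of [derivative_relation] at [0]. *)
Lemma const_even : 0 \notin A -> #|A| = T.*2 -> T%:R = 0 :> F.
Proof.
move=> A0 cA; have := derivative_relation_horner 0.
rewrite mul0r mulr0 oppr0 /rho cA -mul2n natrM exprM sqrrN expr1n expr1n.
move=> e; apply: (mulfI two_neq0); apply: (mulfI two_neq0); rewrite !mulr0.
have p0 : phi.[0] != 0 by rewrite -/(root _ _) root_set_poly.
by apply: (mulIf p0); rewrite mul0r [RHS]e; ring.
Qed.

(** By [diag_constant], (2b)^N and hence b^N is the same for all b in [A]. Evaluating the constant
    Stepanov polynomial at 0 shows that this common value is 1. *)
Lemma in_subgroup : 0 \notin A -> #|A| = T.*2 -> c = (-1) ^+ T ->
  forall a, a \in A -> a ^+ N = 1.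
Proof.
move=> A0 cA cE a aA.
have A_neq0 b : b \in A -> b != 0 by apply: contraTneq => ->.
have e b : b \in A -> b ^+ N = a ^+ N.
  move=> bA; apply: (mulfI (expf_neq0 N two_neq0)); rewrite -!exprMn !mulr_natl !mulr2n.
  by rewrite !diag_constant ?A_neq0.
have := congr1 (fun p => p.[0]) hc; rewrite hornerC cE horner_sum.
under eq_bigr => b bA.
  rewrite hornerZ hornerM !horner_exp hornerXsubC hornerD hornerX hornerC sub0r add0r.
  rewrite exprD e // (exprNn b).
  have -> : weight A b * ((-1) ^+ T * b ^+ T * (a ^+ N * b ^+ T.-1)) =
    weight A b * b ^+ (T + T.-1) * ((-1) ^+ T * a ^+ N) by rewrite exprD; ring.
  over.
rewrite -mulr_suml sum_weight_exp ?cA; last by have := T_gt2; lia.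
have -> : ((T + T.-1).+1 == T.*2)%N by have := T_gt2; lia.
by rewrite mul1r -[RHS]mulr1 => /(mulfI _) -> //; rewrite expf_neq0 // oppr_eq0 oner_eq0.
Qed.

End ConstantStepanov.

(** * Sets of extremal size *)

Section NoLargeSet.
Variables (F : finFieldType) (N d m : nat) (A : {set F}).
Hypothesis two_neq0 : 2 != 0 :> F.
Hypothesis dN : d%:R * N%:R = -1 :> F.
Hypothesis d1 : d%:R + 1 != 0 :> F.
Hypothesis d3 : 3 * d%:R + 1 != 0 :> F.
Hypothesis d6 : 6 * d%:R + 1 != 0 :> F.
Hypothesis d2 : d%:R ^+ 2 + 4 * d%:R + 2 != 0 :> F.
Hypothesis N_gt2 : (2 < N)%N.
Hypothesis hA : sums_in N A.
Hypothesis hN : (N.*2 <= #|A| * #|A|.-1)%N.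
Hypothesis A_gt5 : (5 < #|A|)%N.
Hypothesis hm : (#|A| <= m.*2)%N.
Hypothesis hm' : (m.+2 <= #|A|)%N.
Hypothesis bin_m : 'C(N + m, m)%:R != 0 :> F.

Let N_gt0 : (0 < N)%N := ltn_trans (isT : (0 < 2)%N) N_gt2.

Lemma card_setD1_ge (A' : {set F}) : (#|A'|.-1 <= #|A' :\ 0%R|)%N.
Proof.
have := cardsD1 0 A'; case: (0 \in A') => /= ->; rewrite ?add1n ?add0n //.
exact: leq_pred.
Qed.

Lemma N_neq0F : N%:R != 0 :> F.
Proof.
apply/eqP => h; have /eqP := dN.
by rewrite h mulr0 eq_sym oppr_eq0 oner_eq0.
Qed.

Lemma N_neq1F : N%:R - 1 != 0 :> F.
Proof.
rewrite subr_eq0; apply/eqP => h; have /eqP := dN.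
by rewrite h mulr1 -addr_eq0 (negPf d1).
Qed.

Lemma sums_in_sub (A' : {set F}) : A' \subset A -> sums_in N A'.
Proof. by move=> /fintype.subsetP sA a b aA bA; apply: hA; apply: sA. Qed.

(** If the binomial vanished, the diagonal sums would also lie in the subgroup, and [card_full_le]
    would give (|A| - 1)(m + 1) <= N, against N <= |A| (|A| - 1) / 2 and |A| <= 2m. *)
Lemma bin_constant_neq0 (A' : {set F}) T c : A' \subset A -> (2 < T)%N -> (T.*2 <= #|A'|)%N ->
  (#|A|.-1 <= #|A' :\ 0%R|)%N -> stepanov N A' T T.-1 = c%:P ->
  'C(N + T.-1, T)%:R != 0 :> F.
Proof.
move=> sA T2 TA cA hc; apply/eqP => B0.
have full : (#|A' :\ 0%R| * m.+1 <= N)%N.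
  apply: card_full_le => //; last by apply: leq_trans cA; have := hm'; case: #|A|.
  move=> a b; rewrite !inE => /andP[a0 aA] /andP[b0 bA].
  have [->|ab] := eqVneq a b.
    exact: (diag_trivial two_neq0 N_gt2 (sums_in_sub sA) T2 TA hc B0).
  exact: (sums_in_sub sA).
have := leq_trans (leq_mul cA (leqnn m.+1)) full.
have := hN; have := hm; have := hm'; have := A_gt5; case: #|A| => // k /=.
by move=> *; nia.
Qed.

Lemma card_even_absurd T : #|A| = T.*2 -> False.
Proof.
move=> cA; have T2 : (2 < T)%N by have := A_gt5; rewrite cA; lia.
have NT : (N <= T * (T.*2.-1))%N by have := hN; rewrite cA -!mul2n -mulnA leq_pmul2l.
have tm : (T + T.-1).+1 = #|A| by rewrite cA; move: T2; clear; lia.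
have hc : stepanov N A T T.-1 = ((-1) ^+ T)%:P.
  apply/eqP; rewrite -subr_eq0; apply/negPn/negP => ne.
  have : (\sum_(a in A) T < N.+1)%N.
    apply: leq_trans (size_stepanov_subC N ((-1) ^+ T) tm); apply: sum_mult_lt_size ne _.
    move=> a aA; have := @dvdp_stepanov F N A T T.-1 a T; rewrite tm eqxx mulr1n.
    apply=> //; last by move: T2; clear; lia.
    by move=> c cA' ca; apply: hA; rewrite // eq_sym.
  by rewrite sum_nat_const cA; move: NT T2; clear; nia.
have B0 : 'C(N + T.-1, T)%:R != 0 :> F.
  apply: (bin_constant_neq0 (subxx A) T2 _ _ hc); first by rewrite cA.
  exact: card_setD1_ge.
have nt := diag_nontrivial two_neq0 N_gt2 hA T2 (eq_leq (esym cA)) hc B0.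
have [A0|A0] := boolP (0 \in A); last first.
  have AN := in_subgroup two_neq0 N_gt2 hA T2 (eq_leq (esym cA)) hc B0 N_neq1F A0 cA erefl.
  have [b bA] : exists b, b \in A by apply/card_gt0P; rewrite cA double_gt0 (ltn_trans _ T2).
  have b0 : b != 0 by apply: contraNneq A0 => <-.
  (* Since [A] lies in the subgroup, 0 can be adjoined to it, and the bound for 2T + 1 elements
     exceeds T(2T - 1). *)
  have : (T.*2.+1 * T <= N)%N.
    apply: (@card_odd_le F N (0 |: A) T b).
    - move=> x y; rewrite !inE => /orP[/eqP->|xA] /orP[/eqP->|yA] xy.
      + by rewrite eqxx in xy.
      + by rewrite add0r AN.
      + by rewrite addr0 AN.
      + exact: hA.
    - by rewrite cardsU1 A0 cA.
    - by move: T2; clear; lia.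
    - by rewrite !inE bA orbT.
    - exact: addrr_neq0.
    - exact: nt.
  by move: NT T2; clear; nia.
have cA1 : #|A :\ 0| = T.-1.*2.+1.
  have := cardsD1 0 A; rewrite A0 cA add1n => e; apply: succn_inj; rewrite -e.
  by move: T2; clear; lia.
have [b bA1] : exists b, b \in A :\ 0 by apply/card_gt0P; rewrite cA1.
move: (bA1); rewrite !inE => /andP[b0 bA].
(* Each a = a + 0 is itself a sum, so [A] without 0 lies in the subgroup, and the odd bound with the
   extra zero 0 meets the upper bound on [N]. *)
have NE : N = (T * (T.*2.-1))%N.
  apply/eqP; rewrite eqn_leq NT /=.
  have -> : (T * T.*2.-1 = T.-1.*2.+1 * T.-1.+1)%N.
    by move: T2; clear; case: T => // T' _; rewrite mulnC doubleS.
  apply: (@card_odd_le0 F N (A :\ 0) T.-1 b) => //.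
  - exact: sums_in_sub (subD1set _ _).
  - by move: T2; clear; lia.
  - exact: addrr_neq0.
  - exact: nt.
  - by rewrite !inE eqxx.
  - by move=> a; rewrite !inE => /andP[a0 aA]; rewrite -[a]addr0 hA.
have NF : N%:R = T%:R * (2 * T%:R - 1) :> F.
  by rewrite NE natrM -subn1 natrB -?mul2n ?natrM // muln_gt0; move: T2; clear; lia.
have /eqP := curvature_even two_neq0 N_gt2 hA T2 (eq_leq (esym cA)) hc B0 N_neq1F bA b0 cA.
rewrite mulf_eq0 => /orP[/eqP T0|/eqP h].
  by have := N_neq0F; rewrite NF T0 mul0r eqxx.
(* The curvature relation at N = T(2T - 1). The root T = 2 means N = 6, hence 6d + 1 = 0; if 2T^2 =
   1, then dT = d + 1 and d^2 + 4d + 2 = 0. *)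
have : 2 * ((T%:R - 2) * (2 * T%:R ^+ 2 - 1)) = 0 :> F.
  apply/eqP; rewrite -oppr_eq0 -h NF; apply/eqP; ring.
move/eqP; rewrite !mulf_eq0 (negPf two_neq0) /= => /orP[]/eqP h'.
  case/eqP: d6; have TE : T%:R = 2 :> F by apply/eqP; rewrite -subr_eq0 h'.
  by move: dN; rewrite NF TE => e; rewrite -(subrr (-1)) -{1}e; ring.
case/eqP: d2; have dT : d%:R * T%:R = d%:R + 1 :> F.
  transitivity ((d%:R : F) * (2 * T%:R ^+ 2 - 1) + d%:R - d%:R * (T%:R * (2 * T%:R - 1))).
    by ring.
  by rewrite h' -NF dN; ring.
transitivity (2 * (d%:R + 1) ^+ 2 - d%:R ^+ 2 : F); first by ring.
rewrite -dT; transitivity (d%:R ^+ 2 * (2 * T%:R ^+ 2 - 1) : F); first by ring.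
by rewrite h' mulr0.
Qed.

Lemma card_odd_absurd T : #|A| = T.*2.+1 -> False.
Proof.
move=> cA; have T2 : (2 < T)%N by have := A_gt5; rewrite cA; lia.
have NT : (N <= T.*2.+1 * T)%N.
  by have := hN; rewrite cA -!mul2n /= mulnCA leq_pmul2l.
have NE b : b \in A -> b != 0 -> (b + b) ^+ N != 1 -> N = (T.*2.+1 * T)%N.
  move=> bA b0 bN; apply/eqP; rewrite eqn_leq NT /=.
  by apply: (@card_odd_le F N A T b) => //; [move: T2; clear; lia | exact: addrr_neq0].
have [A0|A0] := boolP (0 \in A).
  have cA1 : #|A :\ 0| = T.*2.
    by have := cardsD1 0 A; rewrite A0 cA add1n => -[].
  have tm : (T + T.-1).+1 = #|A :\ 0| by rewrite cA1; move: T2; clear; lia.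
  have hA1 : sums_in N (A :\ 0) by apply/sums_in_sub/subD1set.
  have AN a : a \in A :\ 0 -> a ^+ N = 1.
    by rewrite !inE => /andP[a0 aA]; rewrite -[a]addr0 hA.
  have hc : stepanov N (A :\ 0) T T.-1 = ((-1) ^+ T)%:P.
    apply/eqP; rewrite -subr_eq0; apply/negPn/negP => ne.
    (* The removed point 0 comes back as a zero of order 2T, for a total of 2T^2 + 2T, more than
       [N]. *)
    have : (\sum_(a in A) (if a == 0%R then T.*2 else T) < N.+1)%N.
      apply: leq_trans (size_stepanov_subC N ((-1) ^+ T) tm).
      apply: sum_mult_lt_size ne _ => a aA; case: eqP => [->|/eqP a0].
        by rewrite subr0 -cA1 dvdp_stepanov0.
      have := @dvdp_stepanov F N (A :\ 0) T T.-1 a T; rewrite tm eqxx mulr1n.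
      apply=> //; last by move: T2; clear; lia.
      by move=> c; rewrite !inE => /andP[c0 cA'] ca; apply: hA; rewrite // eq_sym.
    rewrite (big_setD1 0) //= eqxx (eq_bigr (fun=> T)) ?sum_nat_const; last first.
      by move=> a; rewrite !inE => /andP[/negPf->].
    by rewrite cA1; move: NT T2; clear; nia.
  have B0 : 'C(N + T.-1, T)%:R != 0 :> F.
    apply: (bin_constant_neq0 (subD1set _ _) T2 _ _ hc); first by rewrite cA1.
    rewrite cA /= -cA1; apply: subset_leq_card; apply/fintype.subsetP => x.
    by rewrite !inE => /andP[-> ->].
  have [b bA1] : exists b, b \in A :\ 0 by apply/card_gt0P; rewrite cA1 double_gt0 (ltn_trans _ T2).
  move: (bA1); rewrite !inE => /andP[b0 bA].
  have nt := diag_nontrivial two_neq0 N_gt2 hA1 T2 (eq_leq (esym cA1)) hc B0 bA1 b0.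
  have T0 : T%:R = 0 :> F.
    apply: (const_even two_neq0 N_gt2 hA1 T2 (eq_leq (esym cA1)) hc B0 N_neq1F) => //.
    by rewrite !inE eqxx.
  by have := N_neq0F; rewrite (NE b bA b0 nt) natrM T0 mulr0 eqxx.
have A_neq0 b : b \in A -> b != 0 by apply: contraTneq => ->.
have hc : stepanov N A T T.-1 = 0%:P.
  apply/eqP/negPn/negP => ne.
  have tm : (T + T.-1 < #|A|)%N by rewrite cA; move: T2; clear; lia.
  (* From 2X = (X + a) + (X - a); the two subtracted constants have opposite signs. As 2 is nonzero
     and 0 is not in [A], the factor 2X is prime to each X - a. *)
  have e : (2%:P * 'X) * stepanov N A T T.-1 =
     (stepanov N A T T - ((-1) ^+ T)%:P) + (stepanov N A T.+1 T.-1 - ((-1) ^+ T.+1)%:P).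
    rewrite /stepanov mulr_sumr.
    transitivity (\sum_(a in A) weight A a *: (('X - a%:P) ^+ T * ('X + a%:P) ^+ (N + T))
      + \sum_(a in A) weight A a *: (('X - a%:P) ^+ T.+1 * ('X + a%:P) ^+ (N + T.-1))).
      rewrite -big_split /=; apply: eq_bigr => a _; rewrite -scalerDr -scalerAr.
      have -> : (N + T = (N + T.-1).+1)%N by rewrite -addnS prednK // (ltn_trans _ T2).
      rewrite !exprS; congr (_ *: _).
      by rewrite -[2]/(1 + 1) polyCD polyC1; ring.
    by rewrite exprS mulN1r polyCN; ring.
  have : (\sum_(a in A) T < size (stepanov N A T T.-1))%N.
    apply: sum_mult_lt_size => [|a aA]; first by rewrite -polyC0.
    have cop : coprimep (('X - a%:P) ^+ T) (2%:P * 'X).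
      apply: coprimep_expl; rewrite coprimep_sym coprimep_XsubC rootM rootC (negPf two_neq0).
      by rewrite rootX A_neq0.
    rewrite -(Gauss_dvdpr _ cop) e.
    have hb c : c \in A -> c != a -> (a + c) ^+ N = 1.
      by move=> cA' ca; apply: hA; rewrite // eq_sym.
    apply: dvdp_add.
      have := @dvdp_stepanov F N A T T a T; rewrite addnn cA eqxx mulr1n.
      by apply.
    have := @dvdp_stepanov F N A T.+1 T.-1 a T; rewrite addSn.
    have -> : (T + T.-1).+2 = #|A| by rewrite cA; move: T2; clear; lia.
    by rewrite eqxx mulr1n; apply; rewrite // ?cA; move: T2; clear; lia.
  have := size_stepanov N tm; rewrite sum_nat_const cA.
  by move: NT T2; clear; set s := size _; nia.
have B0 : 'C(N + T.-1, T)%:R != 0 :> F.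
  apply: (bin_constant_neq0 (subxx A) T2 _ _ hc); first by rewrite cA leqnSn.
  exact: card_setD1_ge.
have hT : (T.*2 <= #|A|)%N by rewrite cA.
have [b bA] : exists b, b \in A by apply/card_gt0P; rewrite cA.
have nt := diag_nontrivial two_neq0 N_gt2 hA T2 hT hc B0 bA (A_neq0 b bA).
have NF : N%:R = (2 * T%:R + 1) * T%:R :> F.
  by rewrite (NE b bA (A_neq0 b bA) nt) natrM mulrSr -mul2n natrM.
have /eqP := curvature_odd two_neq0 N_gt2 hA T2 hT hc B0 N_neq1F bA (A_neq0 b bA) cA.
rewrite mulf_eq0 => /orP[/eqP T0|/eqP h].
  by have := N_neq0F; rewrite NF T0 mulr0 eqxx.
(* The curvature relation at N = T(2T + 1). The root T = 1 gives N = 3 and 3d + 1 = 0, while T = -1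
   gives N = 1. *)
have : 2 * (2 * ((T%:R - 1) * ((T%:R + 1) * (T%:R + 1)))) = 0 :> F.
  apply/eqP; rewrite -oppr_eq0 -h NF; apply/eqP; ring.
move/eqP; rewrite !mulf_eq0 (negPf two_neq0) /= => /orP[/eqP h'|/orP h'].
  case/eqP: d3; have TE : T%:R = 1 :> F by apply/eqP; rewrite -subr_eq0 h'.
  by move: dN; rewrite NF TE => e; rewrite -(subrr (-1)) -{1}e; ring.
have {}h' : T%:R + 1 = 0 :> F by case: h' => /eqP.
case/eqP: N_neq1F; rewrite NF.
transitivity ((T%:R + 1) * (2 * T%:R - 1) : F); first by ring.
by rewrite h' mul0r.
Qed.

Lemma no_large_set : False.
Proof.
have [oA|eA] := boolP (odd #|A|).
  by apply: (@card_odd_absurd #|A|./2); rewrite -[LHS]odd_double_half oA.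
by apply: (@card_even_absurd #|A|./2); rewrite -[LHS]odd_double_half (negPf eA).
Qed.

End NoLargeSet.

(** * Restricted sumsets in a finite field *)

(* To be used with [P] = p^(ceil(s/2) - 1) and [v] the common base-[p] digit of the
   index (q - 1) / d, which is (p - 1) / d: the multiple [P * j] of [P] is taken just above [n / 2],
   and [v + j < p] excludes a carry in base [p], so that by Lucas
   C(N + P j, P j) is nonzero modulo [p]. *)
Lemma exists_half_multiple (p d n N P v : nat) :
  (2 < d)%N -> (100 * d ^ 2 <= p)%N -> (0 < P)%N -> (d * v).+1 = p ->
  (P ^ 2 * p <= (d * N).+1)%N -> ((d * N).+1 <= P ^ 2 * p ^ 2)%N ->
  (N.*2 <= n * n.-1)%N -> (n.-1 * n.-2 < N.*2)%N ->
  exists j, [/\ (n <= (P * j).*2)%N, ((P * j).+2 <= n)%N & (v + j < p)%N].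
Proof.
move=> d2 pd P0 vE lo hi hn hn'.
have p900 : (900 <= p)%N by nia.
(* A smaller [n] would force N <= 6P^2, too small for P^2 p <= dN + 1. This room later yields P j +
   2 <= n. *)
have n_ge : (P.*2 + 3 <= n)%N.
  rewrite leqNgt; apply/negP => n_lt.
  have h1 : (n * n.-1 <= P.*2.+2 * P.*2.+1)%N by apply: leq_mul; lia.
  have h2 : (P.*2.+2 * P.*2.+1 <= 12 * P ^ 2)%N by nia.
  have h3 : (N <= 6 * P ^ 2)%N by lia.
  have h4 : (P ^ 2 * p <= P ^ 2 * (6 * d + 1))%N.
    apply: leq_trans lo _; rewrite mulnDr muln1 -addn1 leq_add ?expn_gt0 ?P0 //.
    by rewrite mulnA (mulnC d) leq_mul2r mulnC h3 orbT.
  have : (p <= 6 * d + 1)%N by rewrite -(leq_pmul2l (_ : 0 < P ^ 2)%N) ?expn_gt0 ?P0.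
  by nia.
(* Minimality of [n] gives d(n - 2)^2 < 2dN < 2(Pp)^2, and 2/d <= 2/3 < (5/6)^2. *)
have y_lt : (6 * (n - 2) < 5 * (P * p))%N.
  rewrite ltnNge; apply/negP => ge.
  have h1 : ((n - 2) ^ 2 <= n.-1 * n.-2)%N by rewrite -mulnn leq_mul //; lia.
  have h2 : (3 * (n - 2) ^ 2 < 2 * (P * p) ^ 2)%N.
    rewrite expnMn; have : (d * (n - 2) ^ 2 < d * N.*2)%N.
      by rewrite ltn_pmul2l; [apply: leq_ltn_trans hn' | lia].
    have : (3 * (n - 2) ^ 2 <= d * (n - 2) ^ 2)%N by rewrite leq_mul2r d2 orbT.
    by lia.
  have : ((5 * (P * p)) ^ 2 <= (6 * (n - 2)) ^ 2)%N by rewrite leq_exp2r.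
  by rewrite !expnMn; have : (0 < P ^ 2 * p ^ 2)%N; [rewrite muln_gt0 !expn_gt0; lia | lia].
have P2 : (0 < P.*2)%N by rewrite double_gt0.
pose j := ((n + P.*2.-1) %/ P.*2)%N; exists j.
have h1 : (n <= (P * j).*2)%N.
  have := ltn_ceil (n + P.*2.-1) P2; rewrite -/j mulSn -doubleMr => h.
  by rewrite doubleMr; nia.
have h2 : ((P * j).*2 <= n + P.*2.-1)%N.
  by have := leq_trunc_div (n + P.*2.-1) P.*2; rewrite -/j; nia.
split=> //; first by lia.
(* So j is below 5p/12 + 3/2, while v < p/3; their sum stays below p. *)
have h3 : (P * (12 * j) < P * (5 * p + 18))%N by move: h2 y_lt P0 n_ge; clear; lia.
rewrite ltn_pmul2l // in h3.
have h4 : (3 * v <= d * v)%N by rewrite leq_mul2r d2 orbT.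
by move: h3 h4 vE p900; clear; lia.
Qed.

Section FiniteFieldSums.
Variables (F : finFieldType) (p s d : nat).
Hypothesis p_prime : prime p.
Hypothesis s_gt0 : (0 < s)%N.
Hypothesis cardF : #|F| = (p ^ s)%N.
Hypothesis d_gt2 : (2 < d)%N.
Hypothesis pd : p = 1 %[mod d].
Hypothesis p_large : (100 * d ^ 2 <= p)%N.

Let pchF : p \in [pchar F] := card_finPcharP cardF p_prime.
Let p_gt0 : (0 < p)%N := prime_gt0 p_prime.
Let d_gt0 : (0 < d)%N := ltn_trans (isT : (0 < 2)%N) d_gt2.

Definition index_pow k : nat := ((p ^ k).-1 %/ d)%N.

Lemma index_powE k : (d * index_pow k).+1 = (p ^ k)%N.
Proof.
rewrite mulnC divnK ?prednK ?expn_gt0 ?p_gt0 // -subn1 -eqn_mod_dvd ?expn_gt0 ?p_gt0 //.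
by rewrite -modnXm pd modnXm exp1n.
Qed.

(** Iterated, this says that all base-[p] digits of [index_pow k] equal (p - 1) / d. *)
Lemma index_powD i k : index_pow (i + k) = (index_pow i + p ^ i * index_pow k)%N.
Proof.
apply/eqP; rewrite -(eqn_pmul2l d_gt0) -eqSS index_powE mulnDr -addSn index_powE.
by rewrite mulnCA expnD -(index_powE k) mulnS.
Qed.

Lemma index_pow_ltn k : (index_pow k < p ^ k)%N.
Proof. by rewrite -index_powE ltnS leq_pmull. Qed.

Lemma index_pow_mod k : (0 < k)%N -> index_pow k = index_pow 1 %[mod p].
Proof.
by case: k => // k _; rewrite -add1n index_powD expn1 addnC mulnC modnMDl.
Qed.

Lemma natF_neq0 k : (0 < k < p)%N -> k%:R != 0 :> F.
Proof. by move=> /andP[k0 kp]; rewrite -(dvdn_pcharf pchF) gtnNdvd. Qed.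

Lemma bin_char_neq0 k j : (k %% p + j < p)%N -> 'C(k + j, j)%:R != 0 :> F.
Proof.
elim: j => [|j IHj] kj; first by rewrite bin0 oner_eq0.
have h : ((k + j).+1 * 'C(k + j, j) = j.+1 * 'C(k + j.+1, j.+1))%N.
  by rewrite addnS -mul_bin_diag.
have : (k + j).+1%:R * 'C(k + j, j)%:R != 0 :> F.
  rewrite mulf_neq0 ?IHj //; last by apply: leq_ltn_trans kj; rewrite leq_add2l.
  rewrite -(dvdn_pcharf pchF) {1}(divn_eq k p) -addnA -addnS dvdn_addr ?dvdn_mull //.
  by rewrite gtnNdvd // -addnS.
by rewrite -natrM h natrM mulf_eq0 negb_or => /andP[].
Qed.

(** A case of Lucas: with P = p^r, compare coefficients of X^(Pj) in (X + 1)^i (X^P + 1)^(k + j).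
    Since i < P, only the constant term of the first factor contributes. *)
Lemma bin_char_shift r i k j : (i < p ^ r)%N ->
  'C(i + p ^ r * k + p ^ r * j, p ^ r * j)%:R = 'C(k + j, j)%:R :> F.
Proof.
move=> ir; set P := (p ^ r)%N; have P0 : (0 < P)%N by rewrite expn_gt0 p_gt0.
have co n l : (('X + 1%:P) ^+ n)`_l = 'C(n, l)%:R :> F.
  by rewrite coef_XaddC_exp expr1n.
rewrite -co -addnA -mulnDr exprD exprM.
have -> : ('X + 1%:P) ^+ P = 'X^P + 1%:P :> {poly F}.
  rewrite exprDn_pchar ?expr1n -?polyC_exp ?expr1n //.
  rewrite (eq_pnat _ (@pchar_poly F)) (eq_pnat _ (pcharf_eq pchF)).
  by rewrite pnatX pnat_id ?orbT.
have -> : ('X^P + 1%:P) ^+ (k + j) = (('X + 1%:P) ^+ (k + j)) \Po 'X^P :> {poly F}.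
  by rewrite rmorphXn /= comp_polyD comp_polyX comp_polyC.
have lt0 : (0 < (P * j).+1)%N by [].
rewrite coefM (bigD1 (Ordinal lt0)) //= big1 => [|l l0]; last first.
  rewrite coef_comp_poly_Xn //; case: ifP => [dv|_]; last by rewrite mulr0.
  rewrite [X in X * _]co (@bin_small i) ?mul0r //; apply: leq_trans ir _; rewrite -/P dvdn_leq //.
    by move: l0; rewrite -val_eqE lt0n.
  have le : (l <= P * j)%N by rewrite -ltnS.
  by rewrite -(dvdn_addr _ dv) subnK // dvdn_mulr.
by rewrite addr0 co bin0 mul1r subn0 coef_comp_poly_Xn // dvdn_mulr // mulKn // co.
Qed.

Local Notation N := (index_pow s).

Lemma dN_char : d%:R * N%:R = -1 :> F.
Proof.
apply/eqP; rewrite -addr_eq0 -natrM natr1 index_powE -(dvdn_pcharf pchF).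
by rewrite dvdn_exp.
Qed.

Lemma dpower_exp y : y \in dpowers F d -> y ^+ N = 1.
Proof.
move=> /imsetP[x]; rewrite inE => /andP[_ x0] ->.
apply: (mulIf x0); rewrite -exprM mul1r -exprSr index_powE -cardF.
exact: expf_card.
Qed.

(** The q - 1 = dN nonzero elements are split by x -> x^d into fibres of at most [d] elements. *)
Lemma card_dpowers : (N <= #|dpowers F d|)%N.
Proof.
rewrite -(leq_pmul2l d_gt0) -ltnS index_powE -cardF.
have -> : #|F| = #|[set~ (0 : F)]|.+1 by rewrite cardsC1 prednK //; apply/card_gt0P; exists 0.
rewrite ltnS -sum1_card (partition_big_imset (fun x : F => x ^+ d)) /=.
have -> : [set x ^+ d | x in [set~ (0 : F)]] = dpowers F d.
  by apply/setP => y; apply/imsetP/imsetP => -[x]; rewrite !inE => x0 ->; exists x; rewrite ?inE.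
rewrite mulnC -sum_nat_const; apply: leq_sum => y _; rewrite sum1dep_card.
have sP : size ('X^d - y%:P) = d.+1 by rewrite size_XnsubC.
have P0 : 'X^d - y%:P != 0 by rewrite -size_poly_eq0 sP.
rewrite cardE -ltnS -sP; apply: max_poly_roots P0 _ (enum_uniq _).
apply/allP => x; rewrite mem_enum !inE => /andP[_ /eqP <-].
by rewrite rootE !hornerE subrr.
Qed.

Lemma sums_in_subgroup A : restricted_sumset A = dpowers F d -> sums_in N A.
Proof.
move=> eA a b aA bA ab; apply: dpower_exp; rewrite -eA.
by apply/imset2P; exists a b; rewrite ?inE ?bA.
Qed.

Lemma card_restricted_sumset (A : {set F}) :
  (#|restricted_sumset A|.*2 <= #|A| * #|A|.-1)%N.
Proof.
have <- : ('C(#|A|, 2) * 2 = #|A| * #|A|.-1)%N.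
  by rewrite mulnC mul_bin_left bin1 subn1 mulnC.
rewrite muln2 leq_double -cards_draws.
pose D := [set B : {set F} | B \subset A & #|B| == 2].
apply: leq_trans (leq_imset_card (fun B : {set F} => \sum_(x in B) x) D).
apply/subset_leq_card/fintype.subsetP => y /imset2P[a b aA].
rewrite inE => /andP[bA ab] ->.
apply/imsetP; exists [set a; b]; last by rewrite big_setU1 ?big_set1 ?inE.
by rewrite !inE cards2 ab finset.subUset !finset.sub1set aA bA.
Qed.

Lemma not_restricted_sumset_field : ~ exists A : {set F}, restricted_sumset A = dpowers F d.
Proof.
move=> [A eA].
have hN : exists n, (N.*2 <= n * n.-1)%N.
  exists #|A|; apply: leq_trans (card_restricted_sumset A).
  by rewrite eA leq_double card_dpowers.
have [n hn n_min] := ex_minnP hN.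
have [A' sA' cA'] : exists2 A' : {set F}, A' \subset A & #|A'| = n.
  exists [set x in take n (enum A)].
    by apply/fintype.subsetP => x; rewrite inE => /mem_take; rewrite mem_enum.
  rewrite cardsE (card_uniqP _) ?take_uniq ?enum_uniq //.
  rewrite size_takel // -cardE n_min // (leq_trans _ (card_restricted_sumset A)) //.
  by rewrite eA leq_double card_dpowers.
have [v vE] : exists v, v = index_pow 1 by exists (index_pow 1).
(* With P = p^r, the exponent [s] is 2r + 1 or 2r + 2, so p^s lies between P^2 p and P^2 p^2. *)
pose r := (uphalf s - 1)%N; have rs : (r < s)%N by rewrite /r; lia.
have P0 : (0 < p ^ r)%N by rewrite expn_gt0 p_gt0.
have n_gt5 : (5 < n)%N.
  have : (d * N >= 100 * d ^ 2 - 1)%N.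
    rewrite leq_subLR add1n index_powE (leq_trans p_large) //.
    by rewrite -{1}(expn1 p) leq_exp2l ?prime_gt1.
  move=> lo; rewrite ltnNge; apply/negP => n5.
  have N10 : (N <= 10)%N.
    by rewrite -leq_double (leq_trans hn) // (@leq_mul _ _ 5 4) //; move: n5; clear; lia.
  have : (d * N <= d * 10)%N by rewrite leq_mul2l N10 orbT.
  by move: lo d_gt2; clear; move: (d * N)%N => M; nia.
have hn' : (n.-1 * n.-2 < N.*2)%N.
  by rewrite ltnNge; apply/negP => /n_min; move: n_gt5; clear; lia.
have [|||j [j1 j2 j3]] := @exists_half_multiple p d n N (p ^ r) v d_gt2 p_large P0 _ _ _ hn hn'.
- by rewrite vE index_powE expn1.
- rewrite index_powE -expnM -expnSr leq_exp2l ?prime_gt1 // /r.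
  by move: s_gt0; clear; lia.
- rewrite index_powE -!expnM -expnD leq_exp2l ?prime_gt1 // /r.
  by move: s_gt0; clear; lia.
have Np : (2 < N)%N.
  have : (d * N >= 100 * d ^ 2 - 1)%N.
    rewrite leq_subLR add1n index_powE (leq_trans p_large) //.
    by rewrite -{1}(expn1 p) leq_exp2l ?prime_gt1.
  by move: d_gt2; clear; move: N => M; nia.
have NE : N = (index_pow r + p ^ r * index_pow (s - r))%N.
  by rewrite -index_powD subnKC // ltnW.
apply: (@no_large_set F N d (p ^ r * j) A').
- by rewrite natF_neq0 //; move: p_large d_gt2; clear; nia.
- exact: dN_char.
- by rewrite natr1 natF_neq0 //; move: p_large d_gt2; clear; nia.
- by rewrite -natrM natr1 natF_neq0 //; move: p_large d_gt2; clear; nia.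
- by rewrite -natrM natr1 natF_neq0 //; move: p_large d_gt2; clear; nia.
- by rewrite -natrX -natrM -!natrD natF_neq0 //; move: p_large d_gt2; clear; nia.
- exact: Np.
- by move=> a b aA bA; apply: (sums_in_subgroup eA); apply: (fintype.subsetP sA').
- by rewrite cA'.
- by rewrite cA'.
- by rewrite cA'.
- by rewrite cA'.
(* Dropping the lowest [r] digits of [N] leaves a number with last digit [v], to which j is added
   without carry. *)
rewrite [X in (X + _)%N]NE bin_char_shift ?index_pow_ltn // bin_char_neq0 //.
rewrite index_pow_mod ?subn_gt0 // -vE modn_small //.
by apply: leq_ltn_trans j3; rewrite leq_addr.
Qed.

End FiniteFieldSums.

(** * Primes congruent to 1 modulo d *)

Lemma prod_map_Cyclotomic (R : comNzRingType) n : (0 < n)%N ->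
  \prod_(k <- divisors n) map_poly intr 'Phi_k = 'X^n - 1 :> {poly R}.
Proof.
by move=> n0; rewrite -rmorph_prod prod_Cyclotomic // rmorphB /= map_polyXn rmorph1.
Qed.

Lemma root_Cyclotomic_expr1 (R : comNzRingType) n (z : R) :
  (0 < n)%N -> root (map_poly intr 'Phi_n) z -> z ^+ n = 1.
Proof.
move=> n0 rz; apply/eqP; rewrite -subr_eq0.
have := congr1 (fun q => q.[z]) (prod_map_Cyclotomic R n0).
rewrite (bigD1_seq n) ?divisors_uniq -?dvdn_divisors //= hornerM (rootP rz).
by rewrite mul0r !hornerE => <-.
Qed.

(* A root of order k < n would also be a root of 'Phi_k, hence a double root
   of the separable polynomial 'X^n - 1. *)
Lemma root_Cyclotomic_prim (K : fieldType) n (z : K) :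
  (0 < n)%N -> n%:R != 0 :> K -> root (map_poly intr 'Phi_n) z ->
  n.-primitive_root z.
Proof.
move=> n_gt0 n_neq0 rz; have zn := root_Cyclotomic_expr1 n_gt0 rz.
have [m zm dvd_mn] := prim_order_exists n_gt0 zn.
have [-> // | neq_mn] := eqVneq n m.
have m_gt0 := prim_order_gt0 zm.
have [k dvd_km rk] : exists2 k, (k %| m)%N & root (map_poly intr 'Phi_k) z.
  have : root (\prod_(k <- divisors m) map_poly intr 'Phi_k) z.
    by rewrite prod_map_Cyclotomic // rootE !hornerE (prim_expr_order zm) subrr.
  rewrite rootE horner_prod prodf_seq_eq0 => /hasP[k].
  by rewrite -dvdn_divisors // => dvd_km rk; exists k.
have neq_kn : k != n.
  apply: contraNneq neq_mn => ekn; rewrite eqn_dvd dvd_mn andbT.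
  by rewrite -[X in (X %| _)%N]ekn.
have k_div : k \in divisors n by rewrite -dvdn_divisors // (dvdn_trans dvd_km).
have := congr1 (fun q => q^`().[z]) (prod_map_Cyclotomic K n_gt0).
rewrite (bigD1_seq n) ?divisors_uniq -?dvdn_divisors //= -big_filter.
rewrite (bigD1_seq k) ?filter_uniq ?divisors_uniq ?mem_filter ?neq_kn //=.
rewrite derivM hornerD !hornerM (rootP rz) (rootP rk) !(mul0r, mulr0) addr0.
rewrite derivB derivXn derivC subr0 hornerMn hornerXn -mulr_natl => /esym/eqP.
rewrite mulf_eq0 (negPf n_neq0) /= expf_eq0 => /andP[_ /eqP z0].
by move/eqP: zn; rewrite z0 expr0n eqn0Ngt n_gt0 eq_sym oner_eq0.
Qed.

(** A prime divisor p of 'Phi_d(a), with a a multiple of d M!, cannot divide a, because a^d = 1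
    modulo p. Hence p > M and a has order exactly d modulo p, so d divides p - 1. *)
Lemma unbounded_primes_1_mod d M :
  (0 < d)%N -> exists p, [/\ prime p, (M < p)%N & p = 1 %[mod d]].
Proof.
move=> d_gt0; pose f := 'Phi_d; pose L := (d * M`!)%N.
have L_gt0 : (0 < L)%N by rewrite muln_gt0 d_gt0 fact_gt0.
have sf : (1 < size f)%N by rewrite size_Cyclotomic ltnS totient_gt0.
(* A non-root of [g] is a point where 'Phi_d is none of 0, 1, -1, so that its value has a prime
   divisor. *)
pose g := f * (f ^+ 2 - 1).
have g_neq0 : g != 0.
  apply: mulf_neq0; first by rewrite monic_neq0 ?Cyclotomic_monic.
  rewrite subr_eq0.
  apply: contraTneq sf => f2.
  have : f \is a GRing.unit by apply/unitrP; exists f; rewrite -expr2.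
  by rewrite poly_unitE => /andP[/eqP->].
have [k gk] : exists k, ~~ root g (L * k)%:Z.
  have : ~~ all (root g) [seq (L * k)%:Z | k <- iota 0 (size g)].
    apply/negP => ag; have := max_poly_roots g_neq0 ag.
    rewrite size_map size_iota ltnn => ug; suff: false by [].
    apply: ug; rewrite map_inj_uniq ?iota_uniq // => i j [/eqP].
    by rewrite eqn_pmul2l // => /eqP.
  by case/allPn => _ /mapP[k _ ->] gk; exists k.
set a := (L * k)%N in gk; pose v := `|f.[a%:Z]|%N.
have v_gt1 : (1 < v)%N.
  rewrite ltnNge; apply: contra gk; rewrite rootE !hornerE /v.
  by case: (f.[_]) => [[|[|n]]|[|n]].
pose p := pdiv v; have p_pr : prime p := pdiv_prime v_gt1.
have rz : root (map_poly intr f) (a%:R : 'F_p).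
  rewrite rootE -[a%:R]/(intr a%:Z) horner_map /= -(dvdz_pcharf (pchar_Fp p_pr)).
  exact: pdiv_dvd.
have zn := root_Cyclotomic_expr1 d_gt0 rz.
have a_neq0 : a%:R != 0 :> 'F_p.
  apply/negP => /eqP z0; move/eqP: zn.
  by rewrite z0 expr0n eqn0Ngt d_gt0 eq_sym oner_eq0.
have : ~~ (p %| a)%N by rewrite (dvdn_pcharf (pchar_Fp p_pr)).
rewrite !Euclid_dvdM // !negb_or => /andP[/andP[p_d p_M] _].
have zd : d.-primitive_root (a%:R : 'F_p).
  by apply: root_Cyclotomic_prim; rewrite -?(dvdn_pcharf (pchar_Fp p_pr)).
exists p; split => //.
  by rewrite ltnNge; apply: contra p_M => le_pM; rewrite dvdn_fact ?prime_gt0.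
apply/eqP; rewrite eqn_mod_dvd ?prime_gt0 // (prim_order_dvd zd).
apply/eqP; apply: (mulfI a_neq0); rewrite -exprS subn1 prednK ?prime_gt0 //.
by rewrite mulr1; have := expf_card (a%:R : 'F_p); rewrite card_Fp.
Qed.

(** * Lower density *)

Section Density.
Local Open Scope classical_set_scope.
Implicit Types (B C : set nat) (m x : nat).

Lemma prime_countS B x :
  prime_count B x.+1 = (prime_count B x + (prime x.+1 && `[< B x.+1 >]))%N.
Proof. by rewrite /prime_count -[in LHS]addn1 iotaD count_cat add0n /= addn0. Qed.

Lemma prime_count_unbounded C :
  (forall M, exists p, [/\ prime p, (M < p)%N & C p]) ->
  forall m, exists x0, forall x, (x0 <= x)%N -> (m <= prime_count C x)%N.
Proof.
move=> Cinf; have mono x y : (x <= y)%N -> (prime_count C x <= prime_count C y)%N.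
  by move=> /subnKC <-; elim: (y - x)%N => [|n IHn]; rewrite ?addn0 // addnS
    prime_countS (leq_trans IHn) ?leq_addr.
elim=> [|m [x0 x0P]]; first by exists 0%N.
have [[|p] [p_pr lt_p Cp]] := Cinf x0; first by [].
exists p.+1 => x /mono; apply: leq_trans.
by rewrite prime_countS p_pr asboolT // addn1 ltnS x0P.
Qed.

Lemma prime_count_cofinite B C n x :
  (forall p, prime p -> (n <= p)%N -> C p -> B p) ->
  (prime_count C x <= prime_count (B `&` C) x + n)%N.
Proof.
move=> CB; have lt_n : (count (ltn^~ n) (iota 0 x.+1) <= n)%N.
  rewrite -size_filter -[leqRHS](size_iota 0); apply: uniq_leq_size.
    by rewrite filter_uniq ?iota_uniq.
  by move=> p; rewrite mem_filter !mem_iota => /andP[].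
apply: leq_trans (leq_add (leqnn _) lt_n); rewrite /prime_count -count_predUI.
rewrite (leq_trans _ (leq_addr _ _)) //; apply: sub_count => p /= /andP[p_pr].
move=> /asboolP Cp; rewrite p_pr /=; case: (ltnP p n) => [|le_np]; first by rewrite orbT.
by rewrite orbF; apply/asboolP; split=> //; apply: CB.
Qed.

(** At most [n] primes of [C] are missing from [B], so the quotient is at least 1 - n / c, where the
    count c of [C] eventually exceeds (n + 1) / b. *)
Lemma lower_prime_density_ge (R : realType) B C (n : nat) (b : R) :
  (forall M, exists p, [/\ prime p, (M < p)%N & C p]) ->
  (forall p, prime p -> (n <= p)%N -> C p -> B p) ->
  0 < b -> ((1 - b)%:E <= lower_prime_density R C B)%E.
Proof.
move=> Cinf CB b_gt0.
rewrite /lower_prime_density limn_einf_lim; apply: lime_ge; first exact: is_cvg_einfs.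
have [x0 x0P] := prime_count_unbounded Cinf (Num.bound (n.+1%:R / b)).
near=> N; apply: le_ereal_inf_tmp => _ [x /= le_Nx <-].
have le_x : (x0 <= x)%N by apply: leq_trans le_Nx; near: N; exact: nbhs_infty_ge.
have c_gt0 : n.+1%:R / b < (prime_count C x)%:R.
  apply: lt_le_trans (_ : (Num.bound (n.+1%:R / b))%:R <= _); last by rewrite ler_nat x0P.
  by apply: archi_boundP; rewrite divr_ge0 ?ltW.
have c0 : 0 < (prime_count C x)%:R :> R by apply: le_lt_trans c_gt0; rewrite divr_ge0 ?ltW.
have := prime_count_cofinite x CB; rewrite -(ler_nat R) natrD => le_c.
rewrite lee_fin ler_pdivlMr //; move: c_gt0; rewrite ltr_pdivrMr // -natr1 => c_gt0.
move: le_c c_gt0; set c := (_ C x)%:R; nra.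
Unshelve. all: by end_near. Qed.

End Density.

Theorem theorem1p2 (R : realType) (s d : nat)
    (hs : (0 < s)%N) (hd : (3 <= d)%N)
    (hsd : ~~ odd s -> ~ exists k : nat, d = (2 * k ^ 2)%N) :
  let r := ((uphalf s) - 1)%N in
  ((1 - (d%:R - 1) ^+ r / (4 * d%:R ^+ r) : R)%:E <=
    lower_prime_density R
      [set p : nat | p = 1 %[mod d]]%classic
      [set p : nat | not_restricted_sumset d (p ^ s)]%classic)%E.
Proof.
(* The bound is 1 - b with b > 0, and every prime p = 1 mod d from 100 d^2 on is good. *)
cbv zeta; move: (uphalf s - 1)%N => r; apply: (@lower_prime_density_ge _ _ _ (100 * d ^ 2)).
- by move=> M; apply: unbounded_primes_1_mod; apply: leq_trans hd.
- by move=> p p_pr p_ge p1 F cF; apply: (not_restricted_sumset_field p_pr hs cF).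
have d_gt1 : 1 < d%:R :> R by rewrite ltr1n; apply: leq_trans hd.
rewrite divr_gt0 ?exprn_gt0 ?subr_gt0 // mulr_gt0 ?exprn_gt0 //.
exact: lt_trans d_gt1.
Qed.
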